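(* Consider a rigid body with attitude kinematics $\dot R=R\Omega^\times$ and with measurements $U^m$ of inertially known vectors and $\Omega^m$ of angular velocity in a body-fixed frame. Let $m>0$, let $D\in\mathbb{R}^{3\times3}$ be positive definite, let $\Phi$ and the weight matrix $W$ be as described in the context, and put $\omega:=\Omega^m-\hat\Omega-\hat\beta$. Apply the Lagrange-d'Alembert principle with a dissipation term linear in $\omega$, $$\delta\mathcal{S}+\int_{t_0}^{T}\tau_D^{T}\,\Sigma\,\mathrm{d}t=0,\qquad \tau_D=D\omega,$$ to the action functional $$\mathcal{S}=\int_{t_0}^{T}\Big\{\tfrac{m}{2}(\Omega^m-\hat\Omega-\hat\beta)^{T}(\Omega^m-\hat\Omega-\hat\beta)-\Phi\big(\mathcal{U}^0(\hat R,U^m)\big)\Big\}\,\mathrm{d}s,$$ taking first variations with respect to $\hat R$ and $\hat\Omega$ of the form $\delta\hat R=\hat R\Sigma^\times$, $\delta\hat\Omega=\dot\Sigma+\hat\Omega\times\Sigma$, with $\Sigma(t_0)=\Sigma(T)=0$. Then the resulting filter equations are of the form $$\begin{cases}\dot{\hat R}=\hat R\hat\Omega^\times=\hat R(\Omega^m-\omega-\hat\beta)^\times,\\[2pt] m\dot\omega=-m\hat\Omega\times\omega+\Phi'\big(\mathcal{U}^0(\hat R,U^m)\big)S_L(\hat R)-D\omega,\\[2pt] \hat\Omega=\Omega^m-\omega-\hat\beta,\end{cases}$$ where $D$ is the positive definite filter gain matrix, $\hat R(t_0)=\hat R_0$, $\omega(t_0)=\omega_0=\Omega^m_0-\hat\Omega_0-\hat\beta_0$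 (subscript $0$ denoting values at $t_0$), $S_L(\hat R)=\mathrm{vex}\big(L^{T}\hat R-\hat R^{T}L\big)\in\mathbb{R}^3$ and $L=EW(U^m)^{T}$.
   Context: $R\in\mathrm{SO}(3)$ is the rotation matrix from the body frame to the inertial frame and $\Omega\in\mathbb{R}^3$ is the body angular velocity. $(\cdot)^\times:\mathbb{R}^3\to\mathfrak{so}(3)$ is the cross-product isomorphism ($a^\times b=a\times b$) and $\mathrm{vex}:\mathfrak{so}(3)\to\mathbb{R}^3$ is its inverse. $\langle A,B\rangle=\mathrm{tr}(A^{T}B)$. At each instant $k\ge2$ known inertially fixed vectors $e_1,\dots,e_k\in\mathbb{R}^3$ are measured in the body frame as $u_1^m,\dots,u_k^m$ ($k$ may vary over time). Set $E=[e_1\ e_2\ e_1\times e_2]$ and $U^m=[u_1^m\ u_2^m\ u_1^m\times u_2^m]$ if $k=2$; $E=[e_1\cdots e_k]$ and $U^m=[u_1^m\cdots u_k^m]$ if $k>2$. The measurement models are $U^m=R^{T}E+N$ and $\Omega^m=\Omega+w+\beta$, where $N,w$ are measurement noise and $\beta\in\mathbb{R}^3$ is a constant bias. $\hat R\in\mathrm{SO}(3)$, $\hat\Omega,\hat\beta\in\mathbb{R}^3$ are the estimates of $R,\Omega,\beta$. $\mathcal{U}^0(\hat R,U^m)=\tfrac12\langle E-\hat RU^m,(E-\hat RU^m)W\rangle$. $\Phi:[0,\infty)\to[0,\infty)$ is a $C^2$ function with $\Phi(0)=0$, $\Phi'(x)>0$ for all $x\in[0,\infty)$, and $\Phi'(\cdot)\le\alpha(\cdot)$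 where $\alpha(\cdot)$ is a Class-$\mathcal{K}$ function (continuous, strictly increasing on $[0,\infty)$, $\alpha(0)=0$). Choice of $W$: let $n$ be the number of columns of $E$. $E$ has rank $3$ with singular value decomposition $E=U_E\Sigma_EV_E^{T}$, $U_E\in\mathrm{O}(3)$, $V_E\in\mathrm{SO}(n)$, where $\Sigma_E$ is $3\times n$ with positive main diagonal entries $\sigma_1,\sigma_2,\sigma_3$ and zeros elsewhere. $W$ is the positive definite matrix $W=V_EW_0V_E^{T}$, where $W_0$ is an $n\times n$ diagonal matrix with positive diagonal entries whose first three are $d_i/\sigma_i^2$, $i=1,2,3$, with $d_1,d_2,d_3>0$ distinct. Hence $K=EWE^{T}=U_E\,\mathrm{diag}(d_1,d_2,d_3)\,U_E^{T}$ is positive definite with distinct eigenvalues.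
   Formalization: Φ'(0)>0 contradicts Φ'≤α with α(0)=0, so only one of the two is required at 0; the kinematics dR̂/dt=R̂Ω̂^× is assumed as the constraint behind the variations, not derived, since the principle cannot yield it; the ω-equation is asserted off switching times of the observed set. *)

(* Defs.v *)
From HB Require Import structures.
From mathcomp Require Import all_boot all_order all_algebra.
From mathcomp Require Import all_classical all_reals all_analysis.

Set Implicit Arguments.
Unset Strict Implicit.
Unset Printing Implicit Defensive.

Import Order.TTheory GRing.Theory Num.Theory.
Import numFieldNormedType.Exports.

Local Open Scope classical_set_scope.
Local Open Scope ring_scope.

Section LinearAlgebra.
Context {R : realType}.

Definition col3 (x y z : R) : 'cV[R]_3 := \col_i [:: x; y; z]`_i.

Definition dotv n (a b : 'cV[R]_n) : R := (a^T *m b) 0 0.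

Definition cross (a b : 'cV[R]_3) : 'cV[R]_3 :=
  let i0 : 'I_3 := inord 0 in let i1 : 'I_3 := inord 1 in
  let i2 : 'I_3 := inord 2 in
  col3 (a i1 0 * b i2 0 - a i2 0 * b i1 0)
       (a i2 0 * b i0 0 - a i0 0 * b i2 0)
       (a i0 0 * b i1 0 - a i1 0 * b i0 0).

(* Column j of [hat a] is the cross product of a with the j-th basis vector;
   see [hat_mulmx]. *)
Definition hat (a : 'cV[R]_3) : 'M[R]_3 :=
  \matrix_(i, j) cross a (delta_mx j 0) i 0.

(* The inverse of [hat] on skew-symmetric matrices ([hatK], [vexK]); outside
   so(3) its value is irrelevant. *)
Definition vex (A : 'M[R]_3) : 'cV[R]_3 :=
  col3 (A (inord 2) (inord 1)) (A (inord 0) (inord 2)) (A (inord 1) (inord 0)).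

Definition frob m n (A B : 'M[R]_(m, n)) : R := \tr (A^T *m B).

Definition is_orthogonal n (A : 'M[R]_n) : Prop := A^T *m A = 1%:M.

Definition is_special_orthogonal n (A : 'M[R]_n) : Prop :=
  is_orthogonal A /\ \det A = 1.

(* Symmetry of A is not required. *)
Definition posdef n (A : 'M[R]_n) : Prop :=
  forall x : 'cV[R]_n, x != 0 -> 0 < dotv x (A *m x).

Let ord3P (P : 'I_3 -> Prop) :
  P (inord 0) -> P (inord 1) -> P (inord 2) -> forall i, P i.
Proof.
move=> P0 P1 P2 i; rewrite -(inord_val i).
by case: i => [[|[|[|//]]]] /=.
Qed.

Let inord3E : ((inord 0 : 'I_3) = 0 :> nat) * ((inord 1 : 'I_3) = 1 :> nat)
  * ((inord 2 : 'I_3) = 2 :> nat).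
Proof. by rewrite !inordK. Qed.

Let sum3 (F : 'I_3 -> R) :
  \sum_i F i = F (inord 0) + F (inord 1) + F (inord 2).
Proof.
rewrite !big_ord_recr big_ord0 /= add0r.
by congr (F _ + F _ + F _); apply: val_inj; rewrite /= inordK.
Qed.

Let hatE (a : 'cV[R]_3) i j :
  let a0 := a (inord 0) 0 in let a1 := a (inord 1) 0 in
  let a2 := a (inord 2) 0 in
  hat a i j = [:: [:: 0; - a2; a1]`_j; [:: a2; 0; - a0]`_j;
                  [:: - a1; a0; 0]`_j]`_i.
Proof.
rewrite /= /hat /cross /col3 !mxE.
by move: i j; apply: ord3P; apply: ord3P;
  rewrite -!val_eqE /= !inord3E /= !(mulr0, mulr1, subr0, sub0r, oppr0).
Qed.

Lemma hat_mulmx (a b : 'cV[R]_3) : hat a *m b = cross a b.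
Proof.
apply/matrixP => i j; rewrite (ord1 j) mxE sum3 !hatE !mxE.
move: i; apply: ord3P; rewrite !inord3E /= !mul0r !mulNr ?add0r ?addr0 //;
  exact: addrC.
Qed.

Lemma hatK : cancel hat vex.
Proof.
move=> a; apply/matrixP => i j; rewrite (ord1 j) /vex !hatE !mxE.
by move: i; apply: ord3P; rewrite !inord3E.
Qed.

Lemma vexK (A : 'M[R]_3) : A^T = - A -> hat (vex A) = A.
Proof.
move=> skA; have sk i j : A j i = - A i j.
  by move/matrixP: skA => /(_ i j); rewrite !mxE.
have sk0 i : A i i = 0.
  by apply/eqP; have /eqP := sk i i; rewrite -addr_eq0 -mulr2n mulrn_eq0.
apply/matrixP => i j; rewrite hatE !mxE.
by move: i j; apply: ord3P; apply: ord3P;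
  rewrite !inord3E /= ?sk0 // -?sk // -?sk.
Qed.

End LinearAlgebra.

Section Calculus.
Context {R : realType}.

(* Continuous on [a, b] minus the finite set S, with finite one-sided limits
   at all points of [a, b]. *)
Definition piecewise_continuous {V : normedModType R} (S : seq R) (a b : R)
    (f : R -> V) : Prop :=
  [/\ forall t, t \in `]a, b[ -> t \notin S -> {for t, continuous f},
      forall t, t \in `[a, b[ -> cvg (f @ t^'+) &
      forall t, t \in `]a, b] -> cvg (f @ t^'-)].

Definition piecewise_C1 {V : normedModType R} (S : seq R) (a b : R)
    (f : R -> V) : Prop :=
  [/\ {within `[a, b], continuous f},
      forall t, t \in `]a, b[ -> t \notin S -> derivable f t 1 &
      piecewise_continuous S a b (derive1 f)].

(* df is the derivative of f, one-sided at the end points. *)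
Definition C1_on {V : normedModType R} (a b : R) (f df : R -> V) : Prop :=
  [/\ {within `[a, b], continuous f}, {within `[a, b], continuous df} &
      forall t, t \in `]a, b[ -> is_derive t 1 f (df t)].

(* f' is the derivative of f on [0, +oo), one-sided at 0. *)
Definition derivative_nonneg (f f' : R -> R) : Prop :=
  forall x, 0 <= x ->
    (f y - f x) / (y - x)
      @[y --> within [set y | 0 <= y /\ y != x] (nbhs x)] --> f' x.

Definition class_K (alpha : R -> R) : Prop :=
  [/\ {within `[0, +oo[, continuous alpha},
      forall x y, 0 <= x -> x < y -> alpha x < alpha y &
      alpha 0 = 0].

(* A positive derivative on all of [0, +oo) and a class-K bound on the
   derivative exclude each other at 0, and only there: the bound forces
   dPhi 0 <= 0. So that neither is lost, Phi is allowed to satisfy either of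
   them at 0, positivity on (0, +oo) being required in both cases. *)
Definition admissible_potential (Phi dPhi : R -> R) : Prop :=
  [/\ (forall x, 0 <= x -> 0 <= Phi x),
      Phi 0 = 0,
      derivative_nonneg Phi dPhi,
      (exists2 d2Phi, derivative_nonneg dPhi d2Phi &
         {within `[0, +oo[, continuous d2Phi}) &
      (forall x, 0 <= x -> 0 < dPhi x) \/
      ((forall x, 0 < x -> 0 < dPhi x) /\
       exists2 alpha, class_K alpha & forall x, 0 <= x -> dPhi x <= alpha x)].

End Calculus.

Section Measurements.
Context {R : realType}.

Definition ncols (k : nat) : nat := if k == 2 then 3 else k.

(* [v_1 v_2 v_1 x v_2] if k = 2 and [v_1 ... v_k] if k > 2, where v_i is
   [v i.-1]. *)
Definition vectors_mx (k : nat) (v : nat -> 'cV[R]_3) : 'M[R]_(3, ncols k) :=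
  \matrix_(i, j) (if (j < k)%N then v j i 0 else cross (v 0) (v 1) i 0).

(* The inertially known vectors observed at some instant, with the weight
   matrix W used for them. *)
Record observation := Observation {
  known : seq 'cV[R]_3;
  weight : 'M[R]_(ncols (size known)) }.

Definition Emx (o : observation) : 'M[R]_(3, ncols (size (known o))) :=
  vectors_mx (size (known o)) (nth 0 (known o)).

Definition Umx (o : observation) (u : nat -> 'cV[R]_3) :
    'M[R]_(3, ncols (size (known o))) :=
  vectors_mx (size (known o)) u.

Definition weight_choice n (E : 'M[R]_(3, n)) (W : 'M[R]_n) : Prop :=
  exists (UE : 'M[R]_3) (VE : 'M[R]_n) (sigma d : 'I_3 -> R) (w0 : 'rV[R]_n),
    [/\ is_orthogonal UE /\ is_special_orthogonal VE,
        (forall i, 0 < sigma i) /\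
          E = UE *m (\matrix_(i, j) (if i == j :> nat then sigma i else 0))
                *m VE^T,
        (forall i, 0 < d i) /\ injective d,
        (forall j, 0 < w0 0 j) /\
          (forall (i : 'I_3) (j : 'I_n),
             i = j :> nat -> w0 0 j = d i / sigma i ^+ 2) &
        W = VE *m diag_mx w0 *m VE^T].

Definition valid_observation (o : observation) : Prop :=
  [/\ (2 <= size (known o))%N, \rank (Emx o) = 3 &
      weight_choice (Emx o) (weight o)].

(* The observed set may change only at the times in S; between them the
   observed vectors are inertially fixed. *)
Definition piecewise_constant {T : Type} (S : seq R) (a b : R) (c : R -> T) :=
  forall t, t \in `]a, b[ -> t \notin S -> \forall s \near t, c s = c t.

Definition U0 (o : observation) (u : nat -> 'cV[R]_3) (Rh : 'M[R]_3) : R :=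
  let D := Emx o - Rh *m Umx o u in 2^-1 * frob D (D *m weight o).

Definition Lmx (o : observation) (u : nat -> 'cV[R]_3) : 'M[R]_3 :=
  Emx o *m weight o *m (Umx o u)^T.

Definition SL (o : observation) (u : nat -> 'cV[R]_3) (Rh : 'M[R]_3) :
    'cV[R]_3 :=
  vex ((Lmx o u)^T *m Rh - Rh^T *m Lmx o u).

End Measurements.

Section Variational.
Context {R : realType}.

(* X is a family of curves on [a, b], indexed by |e| < e0, continuous in (e, t)
   together with its partial derivative dX with respect to e. *)
Definition C1_family {V : normedModType R} (e0 a b : R) (X dX : R -> R -> V) :
    Prop :=
  let box := [set p : R * R | `|p.1| < e0 /\ p.2 \in `[a, b]] in
  [/\ {within box, continuous (fun p => X p.1 p.2)},
      {within box, continuous (fun p => dX p.1 p.2)} &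
      forall e t : R, `|e| < e0 -> t \in `[a, b] ->
        is_derive e 1 (fun e' : R => X e' t) (dX e t)].

(* Variations (Rv e, Ov e) of the curves (Rh, Oh), with attitudes in SO(3),
   whose first variations at e = 0 are Rh Sg^x and dSg + Oh x Sg. *)
Definition variation (a b : R) (Rh : R -> 'M[R]_3) (Oh : R -> 'cV[R]_3)
    (Sg dSg : R -> 'cV[R]_3)
    (Rv : R -> R -> 'M[R]_3) (Ov : R -> R -> 'cV[R]_3) : Prop :=
  exists (e0 : R) (dRv : R -> R -> 'M[R]_3) (dOv : R -> R -> 'cV[R]_3),
    [/\ 0 < e0,
        C1_family e0 a b Rv dRv /\ C1_family e0 a b Ov dOv,
        forall e t : R, `|e| < e0 -> t \in `[a, b] ->
          is_special_orthogonal (Rv e t),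
        forall t, t \in `[a, b] -> Rv 0 t = Rh t /\ Ov 0 t = Oh t &
        forall t, t \in `[a, b] ->
          dRv 0 t = Rh t *m hat (Sg t) /\
          dOv 0 t = dSg t + cross (Oh t) (Sg t)].

Definition velocity_error (Om Oh bh : R -> 'cV[R]_3) (t : R) : 'cV[R]_3 :=
  Om t - Oh t - bh t.

Definition action (t0 tf m : R) (Phi : R -> R) (o : R -> observation)
    (u : R -> nat -> 'cV[R]_3) (Om bh : R -> 'cV[R]_3)
    (Rh : R -> 'M[R]_3) (Oh : R -> 'cV[R]_3) : R :=
  (\int[lebesgue_measure]_(s in `[t0, tf])
     (m / 2 * dotv (velocity_error Om Oh bh s) (velocity_error Om Oh bh s)
      - Phi (U0 (o s) (u s) (Rh s))))%R.

Definition lagrange_dalembert (t0 tf m : R) (D : 'M[R]_3) (Phi : R -> R)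
    (o : R -> observation) (u : R -> nat -> 'cV[R]_3) (Om bh : R -> 'cV[R]_3)
    (Rh : R -> 'M[R]_3) (Oh : R -> 'cV[R]_3) : Prop :=
  forall Sg dSg : R -> 'cV[R]_3,
    C1_on t0 tf Sg dSg -> Sg t0 = 0 -> Sg tf = 0 ->
  forall Rv Ov, variation t0 tf Rh Oh Sg dSg Rv Ov ->
  let S (e : R) := action t0 tf m Phi o u Om bh (Rv e) (Ov e) in
  derivable S 0 1 /\
  derive1 S 0 + (\int[lebesgue_measure]_(t in `[t0, tf])
               dotv (D *m velocity_error Om Oh bh t) (Sg t))%R = 0.

(* The equation for omega is asserted away from the switching times S, where
   U^m may jump. *)
Definition filter_equations (S : seq R) (t0 tf m : R) (D : 'M[R]_3)
    (dPhi : R -> R) (o : R -> observation) (u : R -> nat -> 'cV[R]_3)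
    (Om bh : R -> 'cV[R]_3) (Rh0 : 'M[R]_3) (om0 : 'cV[R]_3)
    (Rh : R -> 'M[R]_3) (Oh om : R -> 'cV[R]_3) : Prop :=
  [/\ forall t, t \in `]t0, tf[ ->
        is_derive t 1 Rh (Rh t *m hat (Oh t)) /\
        Rh t *m hat (Oh t) = Rh t *m hat (Om t - om t - bh t),
      forall t, t \in `]t0, tf[ -> t \notin S ->
        derivable om t 1 /\
        m *: derive1 om t =
          - (m *: cross (Oh t) (om t))
          + dPhi (U0 (o t) (u t) (Rh t)) *: SL (o t) (u t) (Rh t)
          - D *m om t,
      forall t, t \in `[t0, tf] -> Oh t = Om t - om t - bh t &
      Rh t0 = Rh0 /\ om t0 = om0].

End Variational.
Arguments observation : clear implicits.

(* Main.v *)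
Require Import Defs.
From HB Require Import structures.
From mathcomp Require Import all_boot all_order all_algebra.
From mathcomp Require Import all_classical all_reals all_analysis.
From mathcomp Require Import measurable_realfun ring lra.

(** Write om for the velocity error, and let
    A(e) = int m/2 |om_e|^2 - Phi (U0 (R_e)) be the action along a variation
    (R_e, Omega_e) of the estimates with generator Sg.

    Expanding the square in U0 and using R^T R = 1 shows that, on rotations,
    U0 (R) = k - tr (L^T R), where k does not depend on R ([U0E]).  Hence the
    first variation R Sg^x of the attitude changes U0 by
    - tr (L^T R Sg^x) = S_L (R) . Sg ([mxtrace_SL]), while the variation
    Sg' + Omega x Sg of the velocity changes om by its opposite.
    Differentiating under the integral sign gives ([derivable_action])

      A'(0) = int - m om . (Sg' + Omega x Sg) - Phi'(U0) S_L . Sg.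

    Since Sg vanishes at both ends, integrating om . Sg' by parts and permuting
    the triple product turn A'(0) + int D om . Sg into int G . Sg, with

      G = m om' + m Omega x om - Phi'(U0) S_L + D om

    ([lagrange_dalembert_residual]).  The equation for om says that G vanishes
    off the switching times.  If it does, the principle holds.  Conversely,
    every generator Sg comes from a variation inside SO(3), built from the
    Cayley transform ([exists_variation]), so the principle forces
    int G . Sg = 0 for all Sg vanishing at the ends, and G = 0 wherever it is
    continuous ([fundamental_lemma]).

    The analytic difficulty is that the measurements jump at the switching
    times and that Phi is differentiable on the half-line only.  All integrands
    are uniformly bounded and continuous off a finite set (the predicate
    [tame]): this is stable under the operations at hand, and suffices for
    domination under the integral sign and for the fundamental theorem of
    calculus.  Phi is replaced by a differentiable extension to the whole line,
    which changes nothing because U0 is nonnegative. *)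

Set Implicit Arguments.
Unset Strict Implicit.
Unset Printing Implicit Defensive.
Import Order.TTheory GRing.Theory Num.Theory.
Import numFieldNormedType.Exports.
Local Open Scope classical_set_scope.
Local Open Scope ring_scope.

(** * Euclidean geometry of R^3 and the Cayley transform *)

Section linear_algebra.
Context {R : realType}.

Lemma dotvE n (a b : 'cV[R]_n) : dotv a b = \sum_i a i 0 * b i 0.
Proof. by rewrite /dotv mxE; apply: eq_bigr => i _; rewrite mxE. Qed.

Lemma dotvC n (a b : 'cV[R]_n) : dotv a b = dotv b a.
Proof. by rewrite !dotvE; apply: eq_bigr => i _; rewrite mulrC. Qed.

Lemma dotvDl n (a b c : 'cV[R]_n) : dotv (a + b) c = dotv a c + dotv b c.
Proof. by rewrite /dotv linearD/= mulmxDl mxE. Qed.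

Lemma dotvDr n (a b c : 'cV[R]_n) : dotv a (b + c) = dotv a b + dotv a c.
Proof. by rewrite /dotv mulmxDr mxE. Qed.

Lemma dotvNl n (a b : 'cV[R]_n) : dotv (- a) b = - dotv a b.
Proof. by rewrite /dotv linearN/= mulNmx mxE. Qed.

Lemma dotvZl n k (a b : 'cV[R]_n) : dotv (k *: a) b = k * dotv a b.
Proof. by rewrite /dotv linearZ/= -scalemxAl mxE. Qed.

Lemma dotvZr n k (a b : 'cV[R]_n) : dotv a (k *: b) = k * dotv a b.
Proof. by rewrite dotvC dotvZl dotvC. Qed.

Lemma dotv_ge0 n (a : 'cV[R]_n) : 0 <= dotv a a.
Proof. by rewrite dotvE sumr_ge0// => i _; rewrite -expr2 sqr_ge0. Qed.

Lemma dotv_gt0 n (a : 'cV[R]_n) : a != 0 -> 0 < dotv a a.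
Proof.
move=> a0; rewrite dotvE lt_neqAle sumr_ge0 ?andbT; last first.
  by move=> i _; rewrite -expr2 sqr_ge0.
apply: contraNneq a0 => /esym/eqP.
rewrite psumr_eq0; last by move=> i _; rewrite -expr2 sqr_ge0.
move=> /allP a0; apply/eqP/matrixP => i j; rewrite (ord1 j) mxE.
by have := a0 i (mem_index_enum _); rewrite mulf_eq0 orbb => /eqP.
Qed.

Local Notation i0 := (inord 0 : 'I_3).
Local Notation i1 := (inord 1 : 'I_3).
Local Notation i2 := (inord 2 : 'I_3).

Lemma ord3_ind (P : 'I_3 -> Prop) : P i0 -> P i1 -> P i2 -> forall i, P i.
Proof.
move=> P0 P1 P2 i; rewrite -(inord_val i).
by case: i => [[|[|[|//]]]] /=.
Qed.

Lemma sum_ord3 (F : 'I_3 -> R) : \sum_i F i = F i0 + F i1 + F i2.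
Proof.
rewrite !big_ord_recr big_ord0 /= add0r.
by congr (F _ + F _ + F _); apply: val_inj; rewrite /= inordK.
Qed.

Lemma hatE (a : 'cV[R]_3) :
  ((hat a i0 i0 = 0) * (hat a i0 i1 = - a i2 0) * (hat a i0 i2 = a i1 0)) *
  ((hat a i1 i0 = a i2 0) * (hat a i1 i1 = 0) * (hat a i1 i2 = - a i0 0)) *
  ((hat a i2 i0 = - a i1 0) * (hat a i2 i1 = a i0 0) * (hat a i2 i2 = 0)).
Proof.
have D (i j : 'I_3) : (i == j) = (i == j :> nat) by [].
do !split; rewrite /hat /cross /col3 !mxE !D !inordK//=
  !(mulr0, mulr1, subr0, sub0r, oppr0)//.
Qed.

Lemma hatZ (k : R) (a : 'cV[R]_3) : hat (k *: a) = k *: hat a.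
Proof.
move: (hat (k *: a)) (hatE (k *: a)) (hat a) (hatE a) => H HE H' HE'.
apply/matrixP => i j; rewrite [in RHS]mxE; move: i j.
by apply: ord3_ind; apply: ord3_ind; rewrite HE HE' ?mxE; ring.
Qed.

Lemma tr_hat (a : 'cV[R]_3) : (hat a)^T = - hat a.
Proof.
move: (hat a) (hatE a) => H HE; apply/matrixP => i j; rewrite !mxE; move: i j.
by apply: ord3_ind; apply: ord3_ind; rewrite !HE ?opprK ?oppr0.
Qed.

(** The triple product is alternating. *)
Lemma dotv_crossr (a b c : 'cV[R]_3) :
  dotv a (cross b c) = - dotv (cross b a) c.
Proof.
by rewrite -!hat_mulmx /dotv trmx_mul tr_hat mulmxN mulNmx -mulmxA [in RHS]mxE opprK.
Qed.

(** Against a skew matrix, the trace form only sees the skew part of the other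
    factor, and on skew matrices it is minus twice the dot product. *)
Lemma mxtrace_mul_hat (A : 'M[R]_3) (s : 'cV[R]_3) :
  \tr (A *m hat s) = - dotv (vex (A - A^T)) s.
Proof.
move: (hat s) (hatE s) => H HE.
rewrite dotvE /mxtrace /vex /col3 !sum_ord3 !mxE !sum_ord3 !HE !inordK//=; ring.
Qed.

(** Cayley-Hamilton for the skew matrix of a, whose characteristic polynomial
    is X^3 + |a|^2 X. *)
Lemma hat_cube (a : 'cV[R]_3) :
  hat a * hat a * hat a = - dotv a a *: hat a.
Proof.
rewrite dotvE sum_ord3; move: (hat a) (hatE a) => H HE.
apply/matrixP => i j; rewrite -!mulmxE !mxE; move: i j.
by apply: ord3_ind; apply: ord3_ind;
  rewrite !sum_ord3 !mxE !sum_ord3 !HE; ring.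
Qed.

(** This is (1 - a^x)^-1 (1 + a^x), the rotation about a by the angle
    2 arctan |a|.  It plays the role of the exponential: its coefficients are
    rational functions of a, so its derivatives are elementary. *)
Definition cayley (a : 'cV[R]_3) : 'M[R]_3 :=
  1 + (2 / (1 + dotv a a)) *: (hat a + hat a * hat a).

Lemma cayley_so (a : 'cV[R]_3) : is_special_orthogonal (cayley a).
Proof.
have q1 : 1 + dotv a a != 0.
  by rewrite gt_eqF// ltr_pwDl// dotv_ge0.
have A3 := hat_cube a; have At := tr_hat a.
rewrite /is_special_orthogonal /Defs.is_orthogonal /cayley.
move: (dotv a a) q1 A3 => q q1 A3; move: (hat a) At A3 => A At A3.
set c := 2 / (1 + q); have cq : c * (1 + q) = 2 by rewrite /c divfK.
pose C := 1 + c *: (A + A * A).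
have Ct : C^T = 1 + c *: (A * A - A).
  rewrite /C linearD/= trmx1 linearZ/= linearD/= trmx_mul -mulmxE At.
  by rewrite mulNmx mulmxN opprK (addrC (- A)).
have BB : (A * A - A) * (A + A * A) = - (1 + q) *: (A * A).
  rewrite mulrDr mulrBl mulrBl !mulrA A3 -!scalerAl.
  by rewrite addrC addrA addrNK !scaleNr scalerDl scale1r opprD addrC.
have AB : (1 - A) * (A + A * A) = (1 + q) *: A.
  rewrite mulrBl mul1r mulrDr !mulrA A3 addrKA.
  by rewrite scaleNr opprK scalerDl scale1r.
have AC : (1 - A) * C = 1 + A.
  by rewrite /C mulrDr mulr1 -scalerAr AB scalerA cq scaler_nat mulr2n addrA subrK.
(* det (1 - A) = det (1 + A) by transposition, so it only remains to cancel it
   in (1 - A) C = 1 + A; it is nonzero since (1 - A) (C + 1) = 2. *)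
have detA : \det (1 - A) != 0.
  have : \det (1 - A) * \det (C + 1) != 0.
    rewrite -det_mulmx mulmxE mulrDr AC mulr1 addrACA subrr addr0.
    by rewrite -mulr2n -scaler_nat detZ det1 mulr1 expf_neq0// pnatr_eq0.
  by rewrite mulf_eq0 negb_or => /andP[].
rewrite -/C; split.
  rewrite Ct mulmxE /C mulrDl mul1r mulrDr mulr1 -scalerAl -scalerAr BB.
  rewrite !scalerA mulrN -mulrA.
  rewrite cq scaleNr -scalerA -scalerBr -addrA -scalerDr scaler_nat mulr2n.
  by rewrite addrA (addrC A) addrACA subrr addr0 subrr scaler0 addr0.
apply: (mulfI detA); rewrite -det_mulmx mulmxE AC mulr1 -[in RHS]det_tr.
by rewrite linearB/= trmx1 At opprK.
Qed.

Lemma so_mul n (A B : 'M[R]_n) :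
  is_special_orthogonal A -> is_special_orthogonal B ->
  is_special_orthogonal (A *m B).
Proof.
rewrite /is_special_orthogonal /Defs.is_orthogonal => -[Ao A1] [Bo B1].
by rewrite trmx_mul mulmxA -(mulmxA B^T) Ao mulmx1 Bo det_mulmx A1 B1 mulr1.
Qed.

End linear_algebra.

(** * The measurement potential on rotations *)

Section potential_energy.
Context {R : realType}.

Lemma weight_choice_sym n (E : 'M[R]_(3, n)) W : weight_choice E W -> W^T = W.
Proof.
move=> [UE [VE [_ [_ [w0 [_ _ _ _ ->]]]]]].
by rewrite !trmx_mul tr_diag_mx trmxK mulmxA.
Qed.

Lemma weight_choice_ge0 n (E X : 'M[R]_(3, n)) W : weight_choice E W ->
  0 <= frob X (X *m W).
Proof.
move=> [UE [VE [_ [_ [w0 [_ _ _ [w0_gt0 _] ->]]]]]].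
rewrite /frob mxtrace_mulC !mulmxA -(mulmxA _ VE^T) -trmx_mul.
set Y := X *m VE; rewrite /mxtrace sumr_ge0// => i _.
rewrite mxE sumr_ge0// => j _.
by rewrite mul_mx_diag !mxE mulrAC -expr2 mulr_ge0 ?sqr_ge0// ltW.
Qed.

Lemma U0_ge0 (o : observation R) u Rh : valid_observation o -> 0 <= U0 o u Rh.
Proof.
by move=> [_ _ W]; rewrite /U0 mulr_ge0 ?invr_ge0//; exact: weight_choice_ge0 W.
Qed.

(** The part of U0 that is the same for all rotations. *)
Definition U0_offset (o : observation R) (u : nat -> 'cV[R]_3) : R :=
  2^-1 * (\tr ((Emx o)^T *m Emx o *m weight o) +
          \tr ((Umx o u)^T *m Umx o u *m weight o)).

(** On rotations the term quadratic in Rh reduces to tr (U^T U W): U0 is affine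
    in the attitude, and depends on the observation only through one scalar and
    the 3 x 3 matrix L, whatever the number of observed vectors. *)
Lemma U0E (o : observation R) u Rh : valid_observation o ->
  is_special_orthogonal Rh ->
  U0 o u Rh = U0_offset o u - \tr ((Lmx o u)^T *m Rh).
Proof.
move=> [_ _ /weight_choice_sym Wt] [Ro _]; rewrite /U0 /U0_offset /frob /Lmx.
move: (Emx o) (Umx o u) (weight o) Wt => E U W Wt.
have EU : \tr (E^T *m Rh *m U *m W) = \tr ((E *m W *m U^T)^T *m Rh).
  rewrite !trmx_mul trmxK Wt -!mulmxA mxtrace_mulC -!mulmxA mxtrace_mulC.
  by rewrite -!mulmxA.
have UE : \tr (U^T *m Rh^T *m E *m W) = \tr ((E *m W *m U^T)^T *m Rh).
  by rewrite -EU -mxtrace_tr !trmx_mul !trmxK Wt mxtrace_mulC !mulmxA.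
rewrite linearB/= trmx_mul !(mulmxBl, mulmxBr, mulmxA) !raddfB/= UE EU.
by rewrite -(mulmxA U^T Rh^T Rh) Ro mulmx1; field.
Qed.

Lemma mxtrace_SL (o : observation R) u Rh s :
  \tr ((Lmx o u)^T *m (Rh *m hat s)) = - dotv (SL o u Rh) s.
Proof. by rewrite mulmxA mxtrace_mul_hat [(_ *m Rh)^T]trmx_mul trmxK. Qed.

End potential_energy.

(** * Limits and derivatives of matrix-valued functions *)

Lemma cvg_mxP (R : realType) (T : Type) (F : set_system T) (FF : Filter F)
    m n (f : T -> 'M[R]_(m, n)) (M : 'M[R]_(m, n)) :
  f x @[x --> F] --> M <-> forall i j, f x i j @[x --> F] --> M i j.
Proof.
split=> [fM i j|fM].
  exact: (cvg_comp _ _ fM (@coord_continuous R m n i j M)).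
apply/cvgrPdist_le => /= e e0; near=> x.
rewrite /Num.Def.normr/= mx_normrE (bigmax_le _ (ltW e0))//= => i _.
rewrite !mxE/=; move: i; near: x; apply: filter_forall => /= i.
exact: ((cvgrPdist_le _ _).1 (fM i.1 i.2)).
Unshelve. all: by end_near. Qed.

Lemma is_derive_mxP (R : realType) m n (M : R -> 'M[R]_(m, n))
    (dM : 'M[R]_(m, n)) (t : R) :
  is_derive t (1 : R) M dM <->
  forall i j, is_derive t (1 : R) (fun x => M x i j) (dM i j).
Proof.
split=> [[Md <-] i j|Md].
  rewrite derive_mx// mxE; apply: derivableP.
  exact: (derivable_mxP M t 1).1.
have Md' : derivable M t 1.
  by apply/derivable_mxP => i j; have [] := Md i j.
apply: DeriveDef => //; rewrite derive_mx//.
by apply/matrixP => i j; rewrite mxE; have [_ ->] := Md i j.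
Qed.

Lemma within_continuous_mx (R : realType) (T : topologicalType) (A : set T) m n
    (f : T -> 'M[R]_(m, n)) :
  {within A, continuous f} <->
  forall i j, {within A, continuous (fun t => f t i j)}.
Proof.
split=> [cf i j t|cf t].
  by apply/(cvg_mxP _ _ _).1; exact: cf.
by apply/(cvg_mxP _ _ _).2 => i j; exact: cf.
Qed.

Lemma piecewise_continuous_mx (R : realType) m n S (a b : R)
    (f : R -> 'M[R]_(m, n)) i j :
  piecewise_continuous S a b f -> piecewise_continuous S a b (fun t => f t i j).
Proof.
move=> [cf fr fl]; split=> [t tab tS|t /fr|t /fl].
- exact: ((cvg_mxP _ _ _).1 (cf t tab tS)).
- by move=> /cvg_ex[l /(cvg_mxP _ _ _).1 fl']; apply/cvg_ex; exists (l i j).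
- by move=> /cvg_ex[l /(cvg_mxP _ _ _).1 fl']; apply/cvg_ex; exists (l i j).
Qed.

Section limits.
Context {R : realType} {T : Type} {F : set_system T} {FF : Filter F}.

Lemma cvg_sum_ord n (f : 'I_n -> T -> R) (l : 'I_n -> R) :
  (forall i, f i x @[x --> F] --> l i) ->
  (\sum_i f i x) @[x --> F] --> \sum_i l i.
Proof.
elim: n f l => [|n ih] f l fl.
  by rewrite big_ord0; under eq_cvg do rewrite big_ord0; exact: cvg_cst.
rewrite big_ord_recl; under eq_cvg do rewrite big_ord_recl.
by apply: cvgD; [exact: fl|apply: ih => i; exact: fl].
Qed.

Lemma cvg_mulmx m n p (A : T -> 'M[R]_(m, n)) (B : T -> 'M[R]_(n, p))
    (A0 : 'M[R]_(m, n)) (B0 : 'M[R]_(n, p)) :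
  A x @[x --> F] --> A0 -> B x @[x --> F] --> B0 ->
  A x *m B x @[x --> F] --> A0 *m B0.
Proof.
move=> /(cvg_mxP _ _ _).1 AA /(cvg_mxP _ _ _).1 BB.
apply/(cvg_mxP _ _ _).2 => i j; rewrite mxE; under eq_cvg do rewrite mxE.
by apply: cvg_sum_ord => k; apply: cvgM.
Qed.

Lemma cvg_trmx m n (A : T -> 'M[R]_(m, n)) (A0 : 'M[R]_(m, n)) :
  A x @[x --> F] --> A0 -> (A x)^T @[x --> F] --> A0^T.
Proof.
move=> /(cvg_mxP _ _ _).1 AA.
apply/(cvg_mxP _ _ _).2 => i j; rewrite mxE; under eq_cvg do rewrite mxE.
exact: AA.
Qed.

Lemma cvg_mxtrace n (A : T -> 'M[R]_n) (A0 : 'M[R]_n) :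
  A x @[x --> F] --> A0 -> \tr (A x) @[x --> F] --> \tr A0.
Proof.
move=> /(cvg_mxP _ _ _).1 AA.
by apply: cvg_sum_ord => i; exact: AA.
Qed.

Lemma cvg_hat (a : T -> 'cV[R]_3) (a0 : 'cV[R]_3) :
  a x @[x --> F] --> a0 -> hat (a x) @[x --> F] --> hat a0.
Proof.
move=> /(cvg_mxP _ _ _).1 aa; apply/(cvg_mxP _ _ _).2.
apply: ord3_ind; apply: ord3_ind; rewrite hatE; under eq_cvg do rewrite hatE;
  by [exact: cvg_cst|exact: aa|apply: cvgN; exact: aa].
Qed.

Lemma cvg_cross (a b : T -> 'cV[R]_3) (a0 b0 : 'cV[R]_3) :
  a x @[x --> F] --> a0 -> b x @[x --> F] --> b0 ->
  cross (a x) (b x) @[x --> F] --> cross a0 b0.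
Proof.
move=> aa bb; rewrite -hat_mulmx; under eq_cvg do rewrite -hat_mulmx.
by apply: cvg_mulmx => //; exact: cvg_hat.
Qed.

Lemma cvg_dotv n (a b : T -> 'cV[R]_n) (a0 b0 : 'cV[R]_n) :
  a x @[x --> F] --> a0 -> b x @[x --> F] --> b0 ->
  dotv (a x) (b x) @[x --> F] --> dotv a0 b0.
Proof.
move=> aa bb; rewrite /dotv.
by apply: (cvg_mxP _ _ _).1; apply: cvg_mulmx => //; exact: cvg_trmx.
Qed.

Lemma cvg_Umx (o : observation R) (v : T -> nat -> 'cV[R]_3)
    (l : nat -> 'cV[R]_3) :
  (forall i, v x i @[x --> F] --> l i) -> Umx o (v x) @[x --> F] --> Umx o l.
Proof.
move=> vl; apply/(cvg_mxP _ _ _).2 => i j; rewrite mxE.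
under eq_cvg do rewrite mxE; case: ifP => _.
  exact: ((cvg_mxP _ _ _).1 (vl j)).
exact: ((cvg_mxP _ _ _).1 (cvg_cross (vl 0%N) (vl 1%N))).
Qed.

Lemma cvg_U0_offset (o : observation R) (v : T -> nat -> 'cV[R]_3)
    (l : nat -> 'cV[R]_3) :
  (forall i, v x i @[x --> F] --> l i) ->
  U0_offset o (v x) @[x --> F] --> U0_offset o l.
Proof.
move=> vl; have ul := cvg_Umx (o := o) vl; apply: cvgM; first exact: cvg_cst.
apply: cvgD; first exact: cvg_cst.
apply: cvg_mxtrace; apply: cvg_mulmx; last exact: cvg_cst.
by apply: cvg_mulmx => //; exact: cvg_trmx.
Qed.

Lemma cvg_Lmx (o : observation R) (v : T -> nat -> 'cV[R]_3)
    (l : nat -> 'cV[R]_3) :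
  (forall i, v x i @[x --> F] --> l i) ->
  Lmx o (v x) @[x --> F] --> Lmx o l.
Proof.
move=> vl; have ul := cvg_Umx (o := o) vl; apply: cvg_mulmx; first exact: cvg_cst.
exact: cvg_trmx.
Qed.

End limits.

Section derivatives.
Context {R : realType}.
Implicit Types (x : R).

(** Difference quotients in terms of the nearby point y rather than of the
    increment: a case distinction on y (its sign, its being close to x) is then
    immediate. *)
Lemma is_derive_of_slope (f : R -> R) (x l : R) :
  (forall e : R, 0 < e ->
     \forall y \near x, y != x -> `|l - (f y - f x) / (y - x)| <= e) ->
  is_derive x (1 : R) f l.
Proof.
move=> fl.
have H : h^-1 *: ((f \o shift x) (h *: (1 : R)) - f x) @[h --> 0^'] --> l.
  apply/cvgrPdist_le => e /fl fe; near=> h.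
  have h0 : h != 0 by near: h; exact: nbhs_dnbhs_neq.
  have : h + x != x -> `|l - (f (h + x) - f x) / (h + x - x)| <= e.
    near: h; apply: nbhs_dnbhs.
    have : h + x @[h --> 0] --> x.
      rewrite -[X in _ --> X]add0r.
      by apply: cvgD; [exact: cvg_id|exact: cvg_cst].
    by move=> /(_ _ fe).
  rewrite addrK -subr_eq0 addrK => /(_ h0).
  by rewrite /= /shift/= [h *: 1]mulr1 mulrC.
exact: DeriveDef (cvgP l H) (cvg_lim _ H).
Unshelve. all: by end_near. Qed.

Lemma is_derive_sum_ord n (f : 'I_n -> R -> R) (df : 'I_n -> R) x :
  (forall i, is_derive x (1 : R) (f i) (df i)) ->
  is_derive x (1 : R) (fun y => \sum_i f i y) (\sum_i df i).
Proof.
move=> fdf; have -> : (fun y => \sum_i f i y) = \sum_i f i.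
  by apply/funext => y; rewrite fct_sumE.
exact: is_derive_sum.
Qed.

Lemma is_derive_dotv n (v w : R -> 'cV[R]_n) (dv dw : 'cV[R]_n) x :
  is_derive x (1 : R) v dv -> is_derive x (1 : R) w dw ->
  is_derive x (1 : R) (fun y => dotv (v y) (w y))
    (dotv dv (w x) + dotv (v x) dw).
Proof.
move=> /is_derive_mxP vdv /is_derive_mxP wdw.
have -> : (fun y => dotv (v y) (w y)) = (fun y => \sum_i v y i 0 * w y i 0).
  by apply/funext => y; rewrite dotvE.
rewrite !dotvE -big_split/=; apply: is_derive_sum_ord => i.
apply: (is_derive_eq (is_deriveM (vdv i 0) (wdw i 0))).
by rewrite addrC [w x i 0 *: _]mulrC.
Qed.

Lemma is_derive_dotv_self n (v : R -> 'cV[R]_n) (dv : 'cV[R]_n) x :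
  is_derive x (1 : R) v dv ->
  is_derive x (1 : R) (fun y => dotv (v y) (v y)) (2 * dotv (v x) dv).
Proof.
move=> vdv; apply: (is_derive_eq (is_derive_dotv vdv vdv)).
by rewrite dotvC -mulr2n mulr_natl.
Qed.

Lemma mxtrace_trmulE m n (A B : 'M[R]_(m, n)) :
  \tr (A^T *m B) = \sum_i \sum_j A j i * B j i.
Proof.
by apply: eq_bigr => i _; rewrite mxE; apply: eq_bigr => j _; rewrite mxE.
Qed.

Lemma is_derive_mxtrace m n (A : 'M[R]_(m, n)) (B : R -> 'M[R]_(m, n))
    (dB : 'M[R]_(m, n)) x :
  is_derive x (1 : R) B dB ->
  is_derive x (1 : R) (fun y => \tr (A^T *m B y)) (\tr (A^T *m dB)).
Proof.
move=> /is_derive_mxP BdB.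
have -> : (fun y => \tr (A^T *m B y)) =
    (fun y => \sum_i \sum_j A j i * B y j i).
  by apply/funext => y; rewrite mxtrace_trmulE.
rewrite mxtrace_trmulE; apply: is_derive_sum_ord => i.
by apply: is_derive_sum_ord => j; exact: (is_deriveZ (A j i) (BdB j i)).
Qed.

Lemma is_derive_scalemx m n (k : R -> R) (dk e : R) (M : 'M[R]_(m, n)) :
  is_derive e (1 : R) k dk ->
  is_derive e (1 : R) (fun x => k x *: M) (dk *: M).
Proof.
move=> kE; apply/is_derive_mxP => i j; rewrite mxE mulrC.
have -> : (fun x => (k x *: M) i j) = M i j \*: k.
  by apply/funext => x; rewrite mxE mulrC.
exact: is_deriveZ.
Qed.

End derivatives.

(** * Bounded families continuous off a finite set *)

Section tame.
Context {R : realType}.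
Implicit Types (S : seq R) (a b : R).

(** Families, rather than single functions, because differentiating under the
    integral sign needs one bound for all parameters in E.  A single function
    is a family indexed by unit. *)
Definition tame (I : Type) (E : set I) S a b (f : I -> R -> R) : Prop :=
  (forall e t, E e -> t \in `]a, b[ -> t \notin S -> {for t, continuous (f e)})
  /\ exists M : R, forall e t, E e -> t \in `[a, b] -> `|f e t| <= M.

Section closure.
Context (I : Type) (E : set I) (S : seq R) (a b : R).
Implicit Types f g : I -> R -> R.
Local Notation tame := (tame E S a b).

Lemma tame_eq f g :
  (forall e t, E e -> t \in `[a, b] -> f e t = g e t) ->
  tame f -> tame g.
Proof.
move=> fg [cf [M fM]]; split=> [e t Ee tab tS|].
  have tab' : t \in `[a, b] by exact: subset_itv_oo_cc.
  rewrite /prop_for /continuous_at -fg//.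
  apply: cvg_trans (cf e t Ee tab tS); apply: near_eq_cvg.
  apply: filterS (near_in_itvoo tab) => s sab; apply: fg => //.
  exact: subset_itv_oo_cc.
by exists M => e t Ee tab; rewrite -fg//; exact: fM.
Qed.

Lemma tame_cst (c : R) : tame (fun _ _ => c).
Proof.
split=> [*|]; first exact: cvg_cst.
by exists `|c|.
Qed.

Lemma tameD f g : tame f -> tame g -> tame (fun e t => f e t + g e t).
Proof.
move=> [cf [M fM]] [cg [N gN]]; split=> [e t Ee tab tS|].
  by apply: cvgD; [exact: cf|exact: cg].
exists (M + N) => e t Ee tab.
by rewrite (le_trans (ler_normD _ _))// lerD// ?fM ?gN.
Qed.

Lemma tameM f g : tame f -> tame g -> tame (fun e t => f e t * g e t).
Proof.
move=> [cf [M fM]] [cg [N gN]]; split=> [e t Ee tab tS|].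
  by apply: cvgM; [exact: cf|exact: cg].
exists (M * N) => e t Ee tab.
by rewrite normrM ler_pM// ?fM ?gN.
Qed.

Lemma tameN f : tame f -> tame (fun e t => - f e t).
Proof.
move=> [cf [M fM]]; split=> [e t Ee tab tS|].
  by apply: cvgN; exact: cf.
by exists M => e t Ee tab; rewrite normrN fM.
Qed.

Lemma tameB f g : tame f -> tame g -> tame (fun e t => f e t - g e t).
Proof. by move=> tf tg; apply: tameD => //; exact: tameN. Qed.

Lemma tame_sum n (f : 'I_n -> I -> R -> R) :
  (forall i, tame (f i)) -> tame (fun e t => \sum_i f i e t).
Proof.
elim: n f => [|n ih] f tf.
  have -> : (fun e t => \sum_(i < 0) f i e t) = (fun _ _ => 0).
    by apply/funext => e; apply/funext => t; rewrite big_ord0.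
  exact: tame_cst.
have -> : (fun e t => \sum_i f i e t) =
    (fun e t => f ord0 e t + \sum_(i < n) f (lift ord0 i) e t).
  by apply/funext => e; apply/funext => t; rewrite big_ord_recl.
by apply: tameD; [exact: tf|apply: ih => i; exact: tf].
Qed.

(** The bound on f confines its values to a segment, where g is bounded. *)
Lemma tame_comp (g : R -> R) f : continuous g -> tame f ->
  tame (fun e t => g (f e t)).
Proof.
move=> cg [cf [M fM]]; split=> [e t Ee tab tS|].
  by apply: continuous_comp; [exact: cf|exact: cg].
have : compact (g @` `[- M, M]).
  apply: continuous_compact; last exact: segment_compact.
  exact: continuous_subspaceT.
move=> /compact_bounded[N [Nreal gN]]; exists (N + 1) => e t Ee tab.
apply: gN; first by rewrite ltrDl.
by exists (f e t) => //=; rewrite in_itv/= -ler_norml fM.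
Qed.

End closure.

Lemma tame_fiber (I : Type) (E : set I) S a b (f : I -> R -> R) e : E e ->
  tame E S a b f -> tame [set: unit] S a b (fun=> f e).
Proof.
move=> Ee [cf [M fM]]; split=> [_ t _|]; first exact: cf.
by exists M => _ t _; exact: fM.
Qed.

Lemma tame_param (I : Type) (E : set I) S a b (f : R -> R) :
  tame [set: unit] S a b (fun=> f) ->
  tame E S a b (fun=> f).
Proof.
move=> [cf [M fM]]; split=> [_ t _|]; first exact: (cf tt).
by exists M => _ t _; exact: (fM tt).
Qed.

(** Compactness: a bound that holds locally holds on the whole segment. *)
Lemma locally_bounded_segment a b (f : R -> R) :
  (forall t, t \in `[a, b] ->
     exists M : R, \forall s \near t, s \in `[a, b] -> `|f s| <= M) ->
  exists M : R, forall t, t \in `[a, b] -> `|f t| <= M.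
Proof.
move=> lf.
have := (compact_near_coveringP _).1 (@segment_compact R a b).
move=> /(_ R (pinfty_nbhs R) (fun M s => s \in `[a, b] -> `|f s| <= M) _)[].
  move=> t tab; have [M fM] := lf t tab.
  exists ([set s | s \in `[a, b] -> `|f s| <= M], [set N | M <= N]) => /=.
    by split=> //; apply: nbhs_pinfty_ge; exact: num_real.
  by move=> -[s N] /= [fsM MN] sab; rewrite (le_trans (fsM sab)).
move=> M [_ fM]; exists (M + 1) => t tab.
by apply: fM => //; rewrite ltrDl.
Qed.

Lemma one_sided_bounded a b (f : R -> R) :
  (forall t, t \in `[a, b[ ->
     exists M : R, \forall s \near t^'+, `|f s| <= M) ->
  (forall t, t \in `]a, b] ->
     exists M : R, \forall s \near t^'-, `|f s| <= M) ->
  exists M : R, forall t, t \in `[a, b] -> `|f t| <= M.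
Proof.
move=> fr fl; apply: locally_bounded_segment => t.
rewrite in_itv/= => /andP[ta tb].
have [Mr fMr] : exists M : R,
    \forall s \near t, t < s -> s \in `[a, b] -> `|f s| <= M.
  move: tb; rewrite le_eqVlt => /predU1P[->|tb].
    exists 0; near=> s => bs; rewrite in_itv/= => /andP[_] /(lt_le_trans bs).
    by rewrite ltxx.
  have [|M fM] := fr t; first by rewrite in_itv/= ta.
  exists M; near=> s => ts _; move: ts; near: s; exact: fM.
have [Ml fMl] : exists M : R,
    \forall s \near t, s < t -> s \in `[a, b] -> `|f s| <= M.
  move: ta; rewrite le_eqVlt => /predU1P[<-|ta].
    exists 0; near=> s => bs; rewrite in_itv/= => /andP[+ _] => /le_lt_trans.
    by move=> /(_ _ bs); rewrite ltxx.
  have [|M fM] := fl t; first by rewrite in_itv/= ta.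
  exists M; near=> s => ts _; move: ts; near: s; exact: fM.
(* The value at t itself is bounded by neither one-sided bound. *)
exists (Num.max `|f t| (Num.max Mr Ml)).
near=> s => sab; rewrite !le_max.
have [st|ts|->] := ltgtP s t; last by rewrite lexx.
- by apply/orP; right; apply/orP; right; move: st sab; near: s.
- by apply/orP; right; apply/orP; left; move: ts sab; near: s.
Unshelve. all: by end_near. Qed.

Lemma cvg_near_bounded (T : Type) (F : set_system T) (FF : ProperFilter F)
    (f : T -> R) : cvg (f x @[x --> F]) ->
  exists M : R, \forall x \near F, `|f x| <= M.
Proof.
move=> /cvg_ex[l /= /cvg_bounded[M [Mreal fM]]]; exists (M + 1).
by apply: fM; rewrite ltrDl.
Qed.

Lemma tame_piecewise_continuous S a b (f : R -> R) :
  piecewise_continuous S a b f -> tame [set: unit] S a b (fun=> f).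
Proof.
move=> [cf fr fl]; split=> [_ t _|]; first exact: cf.
have [t /fr|t /fl|M fM] := @one_sided_bounded a b f.
- exact: cvg_near_bounded.
- exact: cvg_near_bounded.
- by exists M => _ t _; exact: fM.
Qed.

Lemma tame_within_continuous S a b (f : R -> R) : a < b ->
  {within `[a, b], continuous f} -> tame [set: unit] S a b (fun=> f).
Proof.
move=> ab cf; split=> [_ t _ tab _|].
  by have [+ _ _] := (continuous_within_itvP f ab).1 cf; exact.
have /compact_bounded[M [_ fM]] : compact (f @` `[a, b]).
  by apply: continuous_compact => //; exact: segment_compact.
exists (M + 1) => _ t _ tab; apply: fM; first by rewrite ltrDl.
by exists t.
Qed.

(** A C1 family is only controlled on an open range of parameters; halving the
    range makes it compact, whence the uniform bound. *)
Lemma tame_box S a b (r : R) (X : R -> R -> R) : 0 < r ->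
  {within [set p : R * R | `|p.1| < r /\ p.2 \in `[a, b]],
    continuous (fun p => X p.1 p.2)} ->
  tame `]- (r / 2), r / 2[ S a b X.
Proof.
move=> r0 cX; have r2 : r / 2 < r by rewrite ltr_pdivrMr// ltr_pMr// ltr1n.
split=> [e t /= er tab _|].
  pose B : set (R * R) := (fst @^-1` `]- r, r[) `&` (snd @^-1` `]a, b[).
  have oB : open B.
    by apply: openI; apply: open_comp => [p _|]; try exact: interval_open;
      [exact: cvg_fst|exact: cvg_snd].
  have cX' : {in B, continuous (fun p : R * R => X p.1 p.2)}.
    rewrite -continuous_open_subspace//.
    apply: continuous_subspaceW cX => -[e' t'] [/= + t'ab].
    by rewrite in_itv/= -ltr_norml => ->; split=> //; exact: subset_itv_oo_cc.
  have /cX' cet : (e, t) \in B.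
    rewrite inE; split=> //=; move: er; rewrite !in_itv/= -!ltr_norml.
    by move=> /lt_trans; exact.
  apply: (@continuous_comp _ _ _ (fun s : R => (e, s)) (fun p : R * R => X p.1 p.2)).
    exact: (cvg_pair (cvg_cst e) cvg_id).
  exact: cet.
have cK : compact ((`[- (r / 2), r / 2] : set R) `*` (`[a, b] : set R)).
  by apply: compact_setX; exact: segment_compact.
have /compact_bounded[M [_ XM]] : compact ((fun p : R * R => X p.1 p.2) @`
    ((`[- (r / 2), r / 2] : set R) `*` (`[a, b] : set R))).
  apply: continuous_compact => //; apply: continuous_subspaceW cX => -[e t] /=.
  by rewrite in_itv/= -ler_norml => -[er tab]; split=> //; exact: le_lt_trans r2.
exists (M + 1) => e t er tab; apply: XM; first by rewrite ltrDl.
by exists (e, t) => //=; split=> //; exact: subset_itv_oo_cc.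
Qed.

Definition tame_mx (I : Type) (E : set I) S a b m n
    (A : I -> R -> 'M[R]_(m, n)) : Prop :=
  forall i j, tame E S a b (fun e t => A e t i j).

Section matrices.
Context (I : Type) (E : set I) (S : seq R) (a b : R).
Local Notation tame := (tame E S a b).
Local Notation tame_mx := (tame_mx E S a b).

Lemma tame_mulmx m n p (A : I -> R -> 'M[R]_(m, n))
    (B : I -> R -> 'M[R]_(n, p)) :
  tame_mx A -> tame_mx B -> tame_mx (fun e t => A e t *m B e t).
Proof.
move=> tA tB i j.
have tAB : tame (fun e t => \sum_k A e t i k * B e t k j).
  by apply: tame_sum => k; apply: tameM; [exact: tA|exact: tB].
by apply: tame_eq tAB => e t _ _; rewrite mxE.
Qed.

Lemma tame_trmx m n (A : I -> R -> 'M[R]_(m, n)) :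
  tame_mx A -> tame_mx (fun e t => (A e t)^T).
Proof. by move=> tA i j; apply: tame_eq (tA j i) => e t _ _; rewrite mxE. Qed.

Lemma tame_addmx m n (A B : I -> R -> 'M[R]_(m, n)) :
  tame_mx A -> tame_mx B -> tame_mx (fun e t => A e t + B e t).
Proof.
move=> tA tB i j.
by apply: tame_eq (tameD (tA i j) (tB i j)) => e t _ _; rewrite mxE.
Qed.

Lemma tame_scalemx m n (k : I -> R -> R) (A : I -> R -> 'M[R]_(m, n)) :
  tame k -> tame_mx A -> tame_mx (fun e t => k e t *: A e t).
Proof.
move=> tk tA i j.
by apply: tame_eq (tameM tk (tA i j)) => e t _ _; rewrite mxE.
Qed.

Lemma tame_oppmx m n (A : I -> R -> 'M[R]_(m, n)) :
  tame_mx A -> tame_mx (fun e t => - A e t).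
Proof.
by move=> tA i j; apply: tame_eq (tameN (tA i j)) => e t _ _; rewrite mxE.
Qed.

Lemma tame_dotv n (v w : I -> R -> 'cV[R]_n) :
  tame_mx v -> tame_mx w -> tame (fun e t => dotv (v e t) (w e t)).
Proof. by move=> tv tw; apply: tame_mulmx => //; exact: tame_trmx. Qed.

Lemma tame_mxtrace m n (A B : I -> R -> 'M[R]_(m, n)) :
  tame_mx A -> tame_mx B -> tame (fun e t => \tr ((A e t)^T *m B e t)).
Proof.
move=> tA tB; have tAB := tame_mulmx (tame_trmx tA) tB.
by apply: tame_sum => i; exact: tAB.
Qed.

Lemma tame_col3 (x y z : I -> R -> R) :
  tame x -> tame y -> tame z ->
  tame_mx (fun e t => col3 (x e t) (y e t) (z e t)).
Proof.
move=> tx ty tz i j; move: i; apply: ord3_ind.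
- by apply: tame_eq tx => e t _ _; rewrite mxE inordK.
- by apply: tame_eq ty => e t _ _; rewrite mxE inordK.
- by apply: tame_eq tz => e t _ _; rewrite mxE inordK.
Qed.

Lemma tame_cross (v w : I -> R -> 'cV[R]_3) :
  tame_mx v -> tame_mx w -> tame_mx (fun e t => cross (v e t) (w e t)).
Proof.
move=> tv tw; rewrite /cross; apply: tame_col3;
  by apply: tameB; apply: tameM; [exact: tv|exact: tw|exact: tv|exact: tw].
Qed.

Lemma tame_vex (A : I -> R -> 'M[R]_3) :
  tame_mx A -> tame_mx (fun e t => vex (A e t)).
Proof. by move=> tA; rewrite /vex; apply: tame_col3; exact: tA. Qed.

End matrices.

Lemma tame_within_mx S a b m n (f : R -> 'M[R]_(m, n)) : a < b ->
  {within `[a, b], continuous f} -> tame_mx [set: unit] S a b (fun=> f).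
Proof.
move=> ab cf i j; apply: tame_within_continuous => //.
exact: (within_continuous_mx _ _).1.
Qed.

End tame.

(** * Integral calculus off a finite set *)

Section integral_calculus.
Context {R : realType}.
Implicit Types (S : seq R) (a b : R).

Lemma measurable_off_finite S a b (f : R -> R) :
  (forall t, t \in `]a, b[ -> t \notin S -> {for t, continuous f}) ->
  measurable_fun `[a, b] f.
Proof.
move=> cf.
pose F : set R := `[a, b] `&` [set` [:: a, b & S]].
pose U : set R := `]a, b[ `&` ~` [set` S].
have cS : closed [set` S].
  apply: (accessible_finite_set_closed.1 _); first exact/hausdorff_accessible/Rhausdorff.
  exact: finite_seq.
have oU : open U by apply: openI; [exact: interval_open|exact: closed_openC].
have -> : `[a, b]%classic = U `|` F.
  apply/seteqP; split=> [t/= tab|t /= [[tab _]|[]//]]; last exact: subset_itv_oo_cc.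
  have [tS|tS] := boolP (t \in [:: a, b & S]); [by right|left].
  move: tS; rewrite !inE !negb_or => /and3P[ta tb tS].
  split; last exact/negP.
  by move: tab => /=; rewrite !in_itv/= !le_eqVlt eq_sym (negPf ta) (negPf tb).
(* All subsets of F are countable, so f is measurable on F whatever it is. *)
have finF (A : set R) : measurable (F `&` A).
  apply: countable_measurable; first exact: measurable_set1.
  apply/finite_set_countable/finite_setIl/finite_setIr; exact: finite_seq.
apply/measurable_funU; first exact: open_measurable.
  by rewrite -[F]setIT.
split; last by move=> _ A _.
apply: open_continuous_measurable_fun => // t; rewrite inE => -[tab tS].
by apply: cf => //; exact/negP.
Qed.

Lemma tame_integrable S a b (f : R -> R) : tame [set: unit] S a b (fun=> f) ->
  lebesgue_measure.-integrable `[a, b] (EFin \o f).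
Proof.
move=> [cf [M fM]]; apply: measurable_bounded_integrable => //.
- exact: (@compact_finite_measure R _ (@segment_compact R a b)).
- by apply: (@measurable_off_finite S) => t; exact: (cf tt).
exists M; split; first exact: num_real.
by move=> x Mx t tab; apply: le_trans (ltW Mx); exact: (fM tt).
Qed.

(** The bound shared by all the derivatives is the dominating function. *)
Lemma is_derive_integral S a b (r : R) (f df : R -> R -> R) : 0 < r ->
  (forall e t : R, e \in `]- r, r[ -> t \in `[a, b] ->
     is_derive e (1 : R) (f ^~ t) (df e t)) ->
  tame `]- r, r[ S a b f -> tame `]- r, r[ S a b df ->
  let F e := (\int[lebesgue_measure]_(t in `[a, b]) f e t)%R in
  derivable F 0 1 /\
  derive1 F 0 = (\int[lebesgue_measure]_(t in `[a, b]) df 0 t)%R.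
Proof.
move=> r0 dfE tf [cdf [M dfM]] F.
have r00 : 0 \in `]- r, r[ by rewrite in_itv/= oppr_lt0 r0.
have If (e : R) : `]- r, r[%classic e ->
    lebesgue_measure.-integrable `[a, b] (EFin \o f e).
  by move=> er; apply: tame_integrable; exact: (tame_fiber er tf).
have Df (e t : R) : `]- r, r[%classic e -> `[a, b]%classic t ->
    derivable (f ^~ t) e 1.
  by move=> er tab; have [] := dfE e t er tab.
have dfE' (e t : R) : `]- r, r[%classic e -> `[a, b]%classic t ->
    partial1of2 f e t = df e t.
  by move=> er tab; rewrite partial1of2E; have [_ ->] := dfE e t er tab.
have iM : lebesgue_measure.-integrable `[a, b] (EFin \o cst `|M| : R -> _).
  exact: (@tame_integrable [::] a b (cst `|M|) (tame_cst _ _ _ _ _)).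
have ub (e t : R) : `]- r, r[%classic e -> `[a, b]%classic t ->
    `|partial1of2 f e t| <= cst `|M| t.
  by move=> er tab; rewrite dfE'// (le_trans (dfM e t er tab))// ler_norm.
have M0 (y : R) : 0 <= cst `|M| y by [].
have mab : measurable (`[a, b]%classic : set (measurableTypeR R)) by [].
split; first exact: (derivable_under_integral mab r00 If Df M0 iM ub).
rewrite (differentiation_under_integral mab r00 If Df M0 iM ub).
by apply: eq_Rintegral => t; rewrite inE => tab; exact: dfE'.
Qed.

(** Induction on the exceptional points: each of them splits the segment into
    two segments with fewer exceptional points, on which the mean value theorem
    eventually applies; continuity glues the pieces. *)
Lemma cst_off_finite S a b (h : R -> R) : a <= b ->
  {within `[a, b], continuous h} ->
  (forall t, t \in `]a, b[ -> t \notin S -> is_derive t (1 : R) h 0) ->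
  h a = h b.
Proof.
elim: S a b => [|x S ih] a b ab ch dh.
  have [t tab|c _ /eqP] := @MVT_segment R h (fun=> 0) a b ab _ ch; first exact: dh.
  by rewrite mul0r subr_eq0 => /eqP.
have [xab|xab] := boolP (x \in `]a, b[); last first.
  apply: ih => // t tab tS; apply: dh => //; rewrite inE negb_or tS andbT.
  by apply: contraNneq xab => <-.
move: (xab); rewrite in_itv/= => /andP[ax xb].
have hax : h a = h x.
  apply: (ih a x (ltW ax)) => [|t].
    by apply: continuous_subspaceW ch; apply: subset_itvl; rewrite bnd_simp ltW.
  rewrite in_itv/= => /andP[at' tx] tS; apply: dh.
    by rewrite in_itv/= at'/= (lt_trans tx).
  by rewrite inE negb_or tS andbT lt_eqF.
have cxb : {within `[x, b], continuous h}.
  by apply: continuous_subspaceW ch; apply: subset_itvr; rewrite bnd_simp ltW.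
have dxb t : t \in `]x, b[ -> t \notin S -> is_derive t (1 : R) h 0.
  rewrite in_itv/= => /andP[xt tb] tS; apply: dh.
    by rewrite in_itv/= tb andbT (lt_trans ax).
  by rewrite inE negb_or tS andbT gt_eqF.
by rewrite hax; exact: (ih x b (ltW xb) cxb dxb).
Qed.

(** The indefinite integral of dp is continuous and has derivative dp off S, so
    it differs from p by a constant. *)
Lemma FTC2_off_finite S a b (p dp : R -> R) : a < b ->
  {within `[a, b], continuous p} ->
  (forall t, t \in `]a, b[ -> t \notin S -> is_derive t (1 : R) p (dp t)) ->
  tame [set: unit] S a b (fun=> dp) ->
  (\int[lebesgue_measure]_(t in `[a, b]) dp t)%R = p b - p a.
Proof.
move=> ab cp dpE tdp; have Idp := tame_integrable tdp.
pose P x := parameterized_integral lebesgue_measure a x dp.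
have cP : {within `[a, b], continuous P}.
  exact: parameterized_integral_continuous (ltW ab) Idp.
have : P a - p a = P b - p b.
  apply: (@cst_off_finite S a b (P \- p)); first exact: ltW.
    by move=> t; apply: continuousB; [exact: cP|exact: cp].
  move=> t tab tS; rewrite -(subrr (dp t)); apply: is_deriveB; last exact: dpE.
  move: (tab); rewrite in_itv/= => /andP[at' tb].
  have [|dP <-] := continuous_FTC1_closed tb Idp at'; first exact: (tdp.1 tt).
  by rewrite derive1E; exact: derivableP.
rewrite {1}/P /parameterized_integral set_itv1 Rintegral_set1 sub0r.
by rewrite -[RHS]/(_ - _) => /esym/eqP; rewrite subr_eq => /eqP; rewrite /P addrC.
Qed.

Lemma Rintegral_off_finite_eq0 S a b (f : R -> R) : a < b ->
  tame [set: unit] S a b (fun=> f) ->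
  (forall t, t \in `]a, b[ -> t \notin S -> f t = 0) ->
  (\int[lebesgue_measure]_(t in `[a, b]) f t)%R = 0.
Proof.
move=> ab tf f0.
have df t : t \in `]a, b[ -> t \notin S ->
    is_derive t (1 : R) (cst 0 : R -> R) (f t).
  by move=> tab tS; rewrite f0//; exact: is_derive_cst.
have c0 : {within `[a, b], continuous (cst 0 : R -> R)}.
  by apply: continuous_subspaceT => t; exact: cvg_cst.
by rewrite (FTC2_off_finite ab c0 df tf) subrr.
Qed.

Lemma tame_integral_gt0 S a b (h : R -> R) t :
  tame [set: unit] S a b (fun=> h) ->
  (forall s, s \in `[a, b] -> 0 <= h s) ->
  t \in `]a, b[ -> t \notin S -> 0 < h t ->
  0 < (\int[lebesgue_measure]_(s in `[a, b]) h s)%R.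
Proof.
move=> th h0 tab tS ht0; have Ih := tame_integrable th.
have ht2 : h t / 2 < h t by rewrite ltr_pdivrMr// ltr_pMr// ltr1n.
have [e /= e0 He] : \forall s \near t, (s \in `]a, b[) /\ h t / 2 <= h s.
  apply: filterI; first exact: near_in_itvoo.
  by have /cvgr_ge := th.1 tt t Logic.I tab tS; exact.
(* h is at least h t / 2 on the neighbourhood J of t. *)
pose J : interval R := `[t - e / 2, t + e / 2].
have e2 : 0 < e / 2 by rewrite divr_gt0.
have JP s : s \in J -> (s \in `]a, b[) /\ h t / 2 <= h s.
  rewrite in_itv/= -ler_distl distrC => ste; apply: He => /=.
  by apply: le_lt_trans ste _; rewrite ltr_pdivrMr// ltr_pMr// ltr1n.
have mJ : measurable ([set` J] : set (measurableTypeR R)) by [].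
have mab : measurable (`[a, b]%classic : set (measurableTypeR R)) by [].
have Jab : [set` J] `<=` `[a, b] by move=> s /JP[/subset_itv_oo_cc].
have IJ := integrableS mab mJ Jab Ih.
have Icst : lebesgue_measure.-integrable [set` J] (EFin \o cst (h t / 2) : R -> _).
  exact: (@tame_integrable [::] _ _ (cst (h t / 2)) (tame_cst _ _ _ _ _)).
apply: (@lt_le_trans _ _ (\int[lebesgue_measure]_(s in [set` J]) h s)%R).
  apply: (@lt_le_trans _ _ (\int[lebesgue_measure]_(s in [set` J]) (h t / 2))%R).
    have muJ : lebesgue_measure ([set` J] : set R) = e%:E.
      rewrite lebesgue_measure_itv/= lte_fin ltrD2l gtrN// -EFinB.
      by congr EFin; field.
    rewrite Rintegral_cst//; apply: mulr_gt0; first by rewrite divr_gt0.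
    have -> : fine (lebesgue_measure ([set` J] : set (measurableTypeR R))) = e.
      exact: (congr1 fine muJ).
    by [].
  by apply: (le_Rintegral mJ Icst IJ) => s /JP[].
apply: fine_le.
- exact: integrable_fin_num.
- exact: integrable_fin_num.
- have [mh _] := integrableP _ _ _ Ih.
  exact: ge0_subset_integral.
Qed.

End integral_calculus.

(** * Extension of the potential to the whole line *)

Section potential.
Context {R : realType}.

Definition linear_extension (f f' : R -> R) (x : R) : R :=
  if 0 <= x then f x else f 0 + f' 0 * x.

(** A one-sided derivative at 0 becomes two-sided by extending with the tangent
    line, so the chain rule applies even where U0 vanishes. *)
Lemma is_derive_linear_extension (f f' : R -> R) (x : R) :
  derivative_nonneg f f' ->
  is_derive x (1 : R) (linear_extension f f') (f' (Num.max x 0)).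
Proof.
move=> df; apply: is_derive_of_slope => e e0; rewrite /linear_extension.
have [x0|x0] := leP 0 x; last first.
  near=> y => yx; have y0 : y < 0 by near: y; exact: lt_nbhsl.
  rewrite (leNgt 0 y) y0/= opprD addrACA subrr add0r -mulrBr mulfK ?subrr ?normr0 ?ltW//.
  by rewrite subr_eq0.
have := df x x0; move=> /cvgrPdist_le/(_ e e0) H.
have [x_gt0|x_le0] := ltP 0 x.
  near=> y => yx; have y0 : 0 <= y by near: y; apply: filterS (lt_nbhsr x_gt0) => z /ltW.
  rewrite y0; move: (conj y0 yx); near: y; exact: H.
have x_eq0 : x = 0 by apply/le_anti; rewrite x0 x_le0.
near=> y => yx; have [y0|y0] := leP 0 y.
  by move: (conj y0 yx); near: y; exact: H.
rewrite x_eq0 addrAC subrr add0r subr0 mulfK ?subrr ?normr0 ?ltW//.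
by rewrite lt_eqF.
Unshelve. all: by end_near. Qed.

Lemma derivative_nonneg_continuous (f f' : R -> R) :
  derivative_nonneg f f' -> continuous (fun x : R => f (Num.max x 0)).
Proof.
move=> df x.
have -> : (fun x : R => f (Num.max x 0)) =
    linear_extension f f' \o (fun x : R => Num.max x 0).
  by apply/funext => y; rewrite /linear_extension/= le_max lexx orbT.
apply: continuous_comp.
  by apply: continuous_max; [exact: cvg_id|exact: cvg_cst].
apply/differentiable_continuous/derivable1_diffP.
by have [] := is_derive_linear_extension (Num.max x 0) df.
Qed.

End potential.

(** * Observed sets that switch finitely often *)

Section locally_constant.
Context {R : realType}.

(** The values of o live in a bare type, so connectedness is applied to the
    indicator of the event o x = o s: its derivative is 0. *)
Lemma locally_constant_itv (T : Type) (c d : R) (o : R -> T) :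
  (forall t, t \in `]c, d[ -> \forall s \near t, o s = o t) ->
  forall s t, s \in `]c, d[ -> t \in `]c, d[ -> o s = o t.
Proof.
move=> oc; suff H s t : s \in `]c, d[ -> t \in `]c, d[ -> s <= t -> o s = o t.
  move=> s t scd tcd; have [st|/ltW ts] := leP s t; first exact: H.
  by apply/esym/H.
rewrite !in_itv/= => /andP[cs sd] /andP[ct td] st.
pose h x : R := `[< o x = o s >]%:R.
have dh x : x \in `[s, t] -> is_derive x (1 : R) h 0.
  rewrite in_itv/= => /andP[sx xt].
  have ox : \forall y \near x, o y = o x.
    by apply: oc; rewrite in_itv/= (lt_le_trans cs)// (le_lt_trans xt).
  apply: is_derive_of_slope => e e0; apply: filterS ox => y yx _.
  by rewrite /h yx subrr mul0r subr0 normr0 ltW.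
have hst : h s = h t.
  apply: (@cst_off_finite R [::] s t h st).
    by apply: derivable_within_continuous => x /dh[].
  by move=> x xst _; apply: dh; exact: subset_itv_oo_cc.
move: hst; rewrite /h; case: asboolP => // _; case: asboolP => // _ /eqP.
by rewrite oner_eq0.
Qed.

Lemma near_notin_right (S : seq R) (t : R) : \forall s \near t^'+, s \notin S.
Proof.
elim: S => [|x S ih]; first exact: nearW.
have sx : \forall s \near t^'+, s != x.
  have [xt|tx] := leP x t.
    by apply: filterS (nbhs_right_gt t) => s /(le_lt_trans xt)/gt_eqF ->.
  by apply: filterS (nbhs_right_lt tx) => s /lt_eqF ->.
by apply: filterS2 sx ih => s sx sS; rewrite inE negb_or sx.
Qed.

Lemma near_notin_left (S : seq R) (t : R) : \forall s \near t^'-, s \notin S.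
Proof.
elim: S => [|x S ih]; first exact: nearW.
have sx : \forall s \near t^'-, s != x.
  have [tx|xt] := leP t x.
    by apply: filterS (nbhs_left_lt t) => s /lt_le_trans/(_ tx)/lt_eqF ->.
  by apply: filterS (nbhs_left_gt xt) => s /gt_eqF ->.
by apply: filterS2 sx ih => s sx sS; rewrite inE negb_or sx.
Qed.

Lemma piecewise_constant_right (T : Type) (S : seq R) (a b t : R) (o : R -> T) :
  piecewise_constant S a b o -> t \in `[a, b[ ->
  exists c, \forall s \near t^'+, o s = c.
Proof.
move=> oc; rewrite in_itv/= => /andP[ta tb].
have [e /= e0 H] : \forall s \near t^'+, s \notin S /\ s < b.
  by apply: filterI; [exact: near_notin_right|exact: nbhs_right_lt].
have P s : s \in `]t, (t + e)[ -> (s \in `]a, b[) /\ (s \notin S).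
  rewrite in_itv/= => /andP[ts ste]; have [|//|sS sb] := H s.
    by rewrite /ball_/= distrC gtr0_norm ?subr_gt0// ltrBlDl.
  by rewrite in_itv/= (le_lt_trans ta)// sb.
exists (o (t + e / 2)); near=> s.
apply: (@locally_constant_itv T t (t + e)); first by move=> r /P[]; exact: oc.
  rewrite in_itv/=; apply/andP; split=> //.
  by near: s; apply: nbhs_right_lt; rewrite ltrDl.
by rewrite in_itv/= ltrDl divr_gt0//= ltrD2l ltr_pdivrMr// ltr_pMr// ltr1n.
Unshelve. all: by end_near. Qed.

Lemma piecewise_constant_left (T : Type) (S : seq R) (a b t : R) (o : R -> T) :
  piecewise_constant S a b o -> t \in `]a, b] ->
  exists c, \forall s \near t^'-, o s = c.
Proof.
move=> oc; rewrite in_itv/= => /andP[ta tb].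
have [e /= e0 H] : \forall s \near t^'-, s \notin S /\ a < s.
  by apply: filterI; [exact: near_notin_left|exact: nbhs_left_gt].
have P s : s \in `](t - e), t[ -> (s \in `]a, b[) /\ (s \notin S).
  rewrite in_itv/= => /andP[ts ste]; have [|//|sS sb] := H s.
    by rewrite /ball_/= gtr0_norm ?subr_gt0// ltrBlDl -ltrBlDr.
  by rewrite in_itv/= (lt_le_trans ste)// sb.
exists (o (t - e / 2)); near=> s.
apply: (@locally_constant_itv T (t - e) t); first by move=> r /P[]; exact: oc.
  rewrite in_itv/=; apply/andP; split=> //.
  by near: s; apply: nbhs_left_gt; rewrite ltrBlDl ltrDr.
have e2 : e / 2 < e by rewrite ltr_pdivrMr// ltr_pMr// ltr1n.
by rewrite in_itv/= ltrD2l ltrN2 e2 gtrBl divr_gt0.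
Unshelve. all: by end_near. Qed.

(** On each side of any instant the observed set does not change, so one-sided
    limits of the measured vectors pass to any scalar Q computed from them,
    although Q may go through matrices whose size depends on the observed
    set. *)
Lemma tame_observed (T U : Type) (V : normedModType R) (S : seq R) (a b : R)
    (o : R -> T) (u : R -> U -> V) (Q : T -> (U -> V) -> R) :
  (forall c (F : set_system R) (FF : Filter F) (v : R -> U -> V) l,
     (forall i, v t i @[t --> F] --> l i) -> Q c (v t) @[t --> F] --> Q c l) ->
  piecewise_constant S a b o ->
  (forall i, piecewise_continuous S a b (fun t => u t i)) ->
  tame [set: unit] S a b (fun _ t => Q (o t) (u t)).
Proof.
move=> Qc oc uc; split=> [_ t _ tab tS|].
  have ot := oc t tab tS.
  have H : Q (o t) (u s) @[s --> t] --> Q (o t) (u t).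
    by apply: Qc => i; have [+ _ _] := uc i; exact.
  apply: cvg_trans H; apply: near_eq_cvg.
  by apply: filterS ot => s ->.
have [t tab|t tab|M QM] := @one_sided_bounded R a b (fun t => Q (o t) (u t)).
- have [c oE] := piecewise_constant_right oc tab.
  have ul i : cvg (u s i @[s --> t^'+]) by have [_ + _] := uc i; exact.
  have [M QM] := cvg_near_bounded _ (cvgP _ (Qc c _ _ u _ ul)).
  by exists M; apply: filterS2 oE QM => s ->.
- have [c oE] := piecewise_constant_left oc tab.
  have ul i : cvg (u s i @[s --> t^'-]) by have [_ _ +] := uc i; exact.
  have [M QM] := cvg_near_bounded _ (cvgP _ (Qc c _ _ u _ ul)).
  by exists M; apply: filterS2 oE QM => s ->.
- by exists M => _ t _; exact: QM.
Qed.

End locally_constant.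

(** * First variation of the action *)

Section action_variation.
Context {R : realType} (t0 tf : R) (ht : t0 < tf) (S : seq R)
  (o : R -> observation R) (u : R -> nat -> 'cV[R]_3)
  (ho : forall t, t \in `[t0, tf] -> valid_observation (o t))
  (hoS : piecewise_constant S t0 tf o)
  (huS : forall i, piecewise_continuous S t0 tf (fun t => u t i))
  (m : R) (D : 'M[R]_3)
  (Phi dPhi : R -> R) (hPhi : admissible_potential Phi dPhi)
  (Om bh : R -> 'cV[R]_3) (Rh : R -> 'M[R]_3) (Oh : R -> 'cV[R]_3)
  (hRhSO : forall t, t \in `[t0, tf] -> is_special_orthogonal (Rh t))
  (hRhC : {within `[t0, tf], continuous Rh})
  (hOhC : {within `[t0, tf], continuous Oh})
  (hom : piecewise_C1 S t0 tf (velocity_error Om Oh bh)).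

Local Notation om := (velocity_error Om Oh bh).
Local Notation tame1 := (tame [set: unit] S t0 tf).
Local Notation tame_mx1 := (tame_mx [set: unit] S t0 tf).

Lemma tame_U0_offset : tame1 (fun _ t => U0_offset (o t) (u t)).
Proof.
by apply: tame_observed => // c F FF v l; exact: cvg_U0_offset.
Qed.

Lemma tame_Lmx : tame_mx1 (fun _ t => Lmx (o t) (u t)).
Proof.
move=> i j; apply: (tame_observed (Q := fun c v => Lmx c v i j)) => // c F FF v l vl.
exact: ((cvg_mxP _ _ _).1 (cvg_Lmx vl)).
Qed.

(** All attitudes along a variation are rotations, so the potential may be
    differentiated through its affine expression, in which the observation only
    enters by the scalar and the matrix shown above to be tame. *)
Lemma derivable_action (Sg dSg : R -> 'cV[R]_3) (Rv : R -> R -> 'M[R]_3)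
    (Ov : R -> R -> 'cV[R]_3) :
  Defs.variation t0 tf Rh Oh Sg dSg Rv Ov ->
  let A (e : R) := action t0 tf m Phi o u Om bh (Rv e) (Ov e) in
  derivable A 0 1 /\
  derive1 A 0 = (\int[lebesgue_measure]_(t in `[t0, tf])
    (- m * dotv (velocity_error Om Oh bh t) (dSg t + cross (Oh t) (Sg t))
     - dPhi (U0 (o t) (u t) (Rh t)) * dotv (SL (o t) (u t) (Rh t)) (Sg t)))%R.
Proof.
move=> [r [dRv [dOv [r0 [[cR cdR dR] [cO cdO dO]] SOv R0O0 dR0dO0]]]] A.
have [_ _ dPhiE [d2Phi ddPhiE _] _] := hPhi.
have [com _ _] := hom.
set s := r / 2; have s0 : 0 < s by rewrite divr_gt0.
have sr : s < r by rewrite ltr_pdivrMr// ltr_pMr// ltr1n.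
have er e : e \in `]- s, s[ -> `|e| < r.
  by rewrite in_itv/= -ltr_norml => /lt_trans; exact.
have s00 : 0 \in `]- s, s[ by rewrite in_itv/= oppr_lt0 s0.
(* Where U0 vanishes, the chain rule needs a two-sided derivative of Phi. *)
pose PhiX := linear_extension Phi dPhi.
pose dPhiX x := dPhi (Num.max x 0).
have dPhiXE x : is_derive x (1 : R) PhiX (dPhiX x).
  exact: is_derive_linear_extension.
(* The integrand F in terms of the affine expression p of U0, and its
   derivative dF with respect to the parameter. *)
pose v e t := velocity_error Om (Ov e) bh t.
pose p e t := U0_offset (o t) (u t) - \tr ((Lmx (o t) (u t))^T *m Rv e t).
have pE e t : e \in `]- s, s[ -> t \in `[t0, tf] ->
    p e t = U0 (o t) (u t) (Rv e t).
  by move=> es tab; rewrite U0E//; [exact: ho|apply: SOv => //; exact: er].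
pose F e t := m / 2 * dotv (v e t) (v e t) - PhiX (p e t).
pose dF e t := - m * dotv (v e t) (dOv e t)
  + dPhiX (p e t) * \tr ((Lmx (o t) (u t))^T *m dRv e t).
have tbox k l (X : R -> R -> 'M[R]_(k, l)) :
    {within [set x : R * R | `|x.1| < r /\ x.2 \in `[t0, tf]],
      continuous (fun x => X x.1 x.2)} -> tame_mx `]- s, s[ S t0 tf X.
  by move=> cX i j; apply: tame_box => //; exact: (within_continuous_mx _ _).1.
have tv : tame_mx `]- s, s[ S t0 tf v.
  move=> i j; have tom := tame_param `]- s, s[ (tame_within_mx S ht com i j).
  have tOh := tame_param `]- s, s[ (tame_within_mx S ht hOhC i j).
  apply: tame_eq (tameD tom (tameB tOh (tbox _ _ _ cO i j))) => e t _ _.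
  by rewrite /v /velocity_error !mxE; ring.
have tL : tame_mx `]- s, s[ S t0 tf (fun _ t => Lmx (o t) (u t)).
  by move=> i j; exact: tame_param (tame_Lmx i j).
have tp : tame `]- s, s[ S t0 tf p.
  apply: tameB; first exact: tame_param tame_U0_offset.
  by apply: tame_mxtrace => //; exact: tbox.
have tF : tame `]- s, s[ S t0 tf F.
  apply: tameB; first by apply: tameM; [exact: tame_cst|exact: tame_dotv].
  apply: tame_comp tp => x; apply/differentiable_continuous/derivable1_diffP.
  by have [] := dPhiXE x.
have tdF : tame `]- s, s[ S t0 tf dF.
  apply: tameD.
    by apply: tameM; [exact: tame_cst|apply: tame_dotv => //; exact: tbox].
  apply: tameM; last by apply: tame_mxtrace => //; exact: tbox.
  by apply: tame_comp tp; exact: derivative_nonneg_continuous ddPhiE.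
have FE (e t : R) : e \in `]- s, s[ -> t \in `[t0, tf] ->
    is_derive e (1 : R) (F ^~ t) (dF e t).
  move=> es tab; have e_r := er e es.
  have dv : is_derive e (1 : R) (v ^~ t) (- dOv e t).
    have := is_deriveD (is_deriveB (is_derive_cst (Om t) e 1) (dO e t e_r tab))
      (is_derive_cst (- bh t) e 1).
    by rewrite sub0r addr0.
  have dp : is_derive e (1 : R) (p ^~ t)
      (0 - \tr ((Lmx (o t) (u t))^T *m dRv e t)).
    by apply: is_deriveB; apply: is_derive_mxtrace; exact: dR.
  have := is_deriveB (is_deriveZ (m / 2) (is_derive_dotv_self dv))
    (@is_derive1_comp R PhiX (p ^~ t) e _ _ (dPhiXE (p e t)) dp).
  move=> H; apply: (is_derive_eq H).
  by rewrite /dF dotvC dotvNl dotvC [m / 2 *: _]mulrA; field.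
have [dA A'] := is_derive_integral s0 FE tF tdF.
have AE e : e \in `]- s, s[ ->
    A e = (\int[lebesgue_measure]_(t in `[t0, tf]) F e t)%R.
  move=> es; apply: eq_Rintegral => t; rewrite inE => tab.
  by rewrite /F pE// /PhiX /linear_extension U0_ge0//; exact: ho.
have AnearE : \forall e \near (0 : R),
    (\int[lebesgue_measure]_(t in `[t0, tf]) F e t)%R = A e.
  by apply: filterS (near_in_itvoo s00) => e /AE.
split; first exact: near_eq_derivable AnearE dA.
have -> : derive1 A 0 =
    derive1 (fun e => (\int[lebesgue_measure]_(t in `[t0, tf]) F e t)%R) 0.
  by rewrite !derive1E; apply/esym; apply: near_eq_derive AnearE; exact: oner_neq0.
rewrite A'; apply: eq_Rintegral => t; rewrite inE => tab.
have [R0 O0] := R0O0 t tab; have [dR0 dO0] := dR0dO0 t tab.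
rewrite /dF /dPhiX pE// dR0 dO0 mxtrace_SL R0 /v /velocity_error O0.
by rewrite (max_idPl _) ?mulrN// U0_ge0//; exact: ho.
Qed.

(** The defect of the equation for om. *)
Definition residual (t : R) : 'cV[R]_3 :=
  m *: derive1 om t + m *: cross (Oh t) (om t)
  - dPhi (U0 (o t) (u t) (Rh t)) *: SL (o t) (u t) (Rh t) + D *m om t.

Lemma tame_force : tame_mx1
  (fun _ t => dPhi (U0 (o t) (u t) (Rh t)) *: SL (o t) (u t) (Rh t)).
Proof.
have tR := tame_within_mx S ht hRhC; have tL := tame_Lmx.
have [_ _ _ [d2Phi ddPhiE _] _] := hPhi.
apply: tame_scalemx.
  have tp := tameB tame_U0_offset (tame_mxtrace tL tR).
  apply: tame_eq (tame_comp (derivative_nonneg_continuous ddPhiE) tp).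
  move=> _ t _ tab; rewrite -U0E; [|exact: ho|exact: hRhSO].
  by rewrite (max_idPl _)// U0_ge0//; exact: ho.
apply: tame_vex; apply: tame_addmx (tame_mulmx (tame_trmx tL) tR) _.
exact: tame_oppmx (tame_mulmx (tame_trmx tR) tL).
Qed.

Lemma tame_om : tame_mx1 (fun=> om).
Proof. by have [com _ _] := hom; exact: tame_within_mx. Qed.

Lemma tame_derive_om : tame_mx1 (fun=> derive1 om).
Proof.
have [_ _ cd] := hom => i j; apply: tame_piecewise_continuous.
exact: piecewise_continuous_mx.
Qed.

Lemma tame_Dom : tame_mx1 (fun _ t => D *m om t).
Proof. by apply: tame_mulmx _ tame_om => i j; exact: tame_cst. Qed.

Lemma tame_residual : tame_mx1 (fun=> residual).
Proof.
have tm : tame1 (fun _ _ => m) by exact: tame_cst.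
apply: tame_addmx _ tame_Dom; apply: tame_addmx _ (tame_oppmx tame_force).
apply: tame_addmx; apply: tame_scalemx => //; first exact: tame_derive_om.
by apply: tame_cross _ tame_om; exact: tame_within_mx.
Qed.

Lemma integral_by_parts_om (Sg dSg : R -> 'cV[R]_3) :
  C1_on t0 tf Sg dSg -> Sg t0 = 0 -> Sg tf = 0 ->
  (\int[lebesgue_measure]_(t in `[t0, tf])
     (dotv (derive1 om t) (Sg t) + dotv (om t) (dSg t)))%R = 0.
Proof.
move=> [cSg cdSg SgE] Sg0 Sgf; have [com dom _] := hom.
pose dp t := dotv (derive1 om t) (Sg t) + dotv (om t) (dSg t).
have dpE t : t \in `]t0, tf[ -> t \notin S ->
    is_derive t (1 : R) (fun t => dotv (om t) (Sg t)) (dp t).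
  move=> tab tS; apply: is_derive_dotv (SgE t tab).
  by rewrite derive1E; apply: derivableP; exact: dom.
have tdp : tame1 (fun=> dp).
  apply: tameD; first by apply: tame_dotv tame_derive_om _; exact: tame_within_mx.
  by apply: tame_dotv tame_om _; exact: tame_within_mx.
have cp : {within `[t0, tf], continuous (fun t => dotv (om t) (Sg t))}.
  by move=> t; apply: cvg_dotv; [exact: com|exact: cSg].
rewrite -/dp (FTC2_off_finite ht cp dpE tdp).
by rewrite Sg0 Sgf /dotv !mulmx0 !mxE subrr.
Qed.

(** After integration by parts no derivative of Sg is left, so the principle
    pairs Sg with a curve that does not depend on the variation. *)
Lemma lagrange_dalembert_residual (Sg dSg : R -> 'cV[R]_3)
    (Rv : R -> R -> 'M[R]_3) (Ov : R -> R -> 'cV[R]_3) :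
  C1_on t0 tf Sg dSg -> Sg t0 = 0 -> Sg tf = 0 ->
  Defs.variation t0 tf Rh Oh Sg dSg Rv Ov ->
  let A (e : R) := action t0 tf m Phi o u Om bh (Rv e) (Ov e) in
  derivable A 0 1 /\
  derive1 A 0 + (\int[lebesgue_measure]_(t in `[t0, tf])
               dotv (D *m om t) (Sg t))%R =
  (\int[lebesgue_measure]_(t in `[t0, tf]) dotv (residual t) (Sg t))%R.
Proof.
move=> C1 Sg0 Sgf var A; have [cSg cdSg SgE] := C1.
have [dA ->] := derivable_action var.
split; first by [].
have tSg := tame_within_mx S ht cSg; have tdSg := tame_within_mx S ht cdSg.
have tcst (c : R) : tame1 (fun _ _ => c) by exact: tame_cst.
pose dp t := dotv (derive1 om t) (Sg t) + dotv (om t) (dSg t).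
pose dL t := - m * dotv (om t) (dSg t + cross (Oh t) (Sg t))
  - dPhi (U0 (o t) (u t) (Rh t)) * dotv (SL (o t) (u t) (Rh t)) (Sg t).
have tdp : tame1 (fun=> dp).
  exact: tameD (tame_dotv tame_derive_om tSg) (tame_dotv tame_om tdSg).
have tdL : tame1 (fun=> dL).
  apply: tameB.
    apply: tameM => //; apply: tame_dotv tame_om _.
    by apply: tame_addmx tdSg _; apply: tame_cross _ tSg; exact: tame_within_mx.
  by apply: tame_eq (tame_dotv tame_force tSg) => _ t _ _; rewrite dotvZl.
have tDom := tame_dotv tame_Dom tSg.
have tsum := tameD tdL tDom.
have mtab : measurable (`[t0, tf]%classic : set (measurableTypeR R)) by [].
have tmdp := tameM (tcst m) tdp.
rewrite -(RintegralD mtab (tame_integrable tdL) (tame_integrable tDom)).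
(* Adding m times the vanishing integral of (om . Sg)' removes Sg'. *)
rewrite -[LHS]addr0 -(mulr0 m) -(integral_by_parts_om C1 Sg0 Sgf).
rewrite -(RintegralZl _ mtab (tame_integrable tdp)).
rewrite -(RintegralD mtab (tame_integrable tsum) (tame_integrable tmdp)).
apply: eq_Rintegral => t _; rewrite /dL /dp /residual.
move: (derive1 om t) (om t) (SL _ _ _) => dw w sl.
by rewrite !dotvDl dotvNl !dotvZl dotvDr dotv_crossr; ring.
Qed.

End action_variation.

(** * The fundamental lemma of the calculus of variations *)

Section fundamental_lemma.
Context {R : realType}.
Implicit Types (S : seq R) (a b : R).

(** The square of the positive part: a C1 cutoff, from which bump functions are
    made by composing with polynomials. *)
Definition pos_sqr (x : R) : R := Num.max x 0 ^+ 2.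

Lemma pos_sqr_ge0 x : 0 <= pos_sqr x.
Proof. exact: sqr_ge0. Qed.

Lemma pos_sqr_gt0 x : (0 < pos_sqr x) = (0 < x).
Proof.
rewrite /pos_sqr exprn_even_gt0//=; case: (leP x 0) => [x0|/gt_eqF ->//].
by rewrite eqxx.
Qed.

Lemma is_derive_pos_sqr x : is_derive x (1 : R) pos_sqr (2 * Num.max x 0).
Proof.
have -> : pos_sqr = linear_extension (fun x => x ^+ 2) (fun x => 2 * x).
  apply/funext => {}x; rewrite /pos_sqr /linear_extension; case: leP => // _.
  by rewrite expr0n mulr0 mul0r addr0.
apply: is_derive_linear_extension => {}x x0.
have H : y + x @[y --> within [set y | 0 <= y /\ y != x] (nbhs x)] --> 2 * x.
  apply: cvg_within_filter; rewrite (_ : 2 * x = x + x); last by rewrite mulr_natl.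
  by apply: cvgD; [exact: cvg_id|exact: cvg_cst].
apply: cvg_trans H; apply: near_eq_cvg; near=> y.
have [y0 yx] : [set y | 0 <= y /\ y != x] y by near: y; exact: withinT.
by rewrite subr_sqr mulrC mulKf// subr_eq0.
Unshelve. all: by end_near. Qed.

(** If G t is not 0, test against Sg = phi G(t), where phi is a bump at t so
    narrow that G . G(t) stays nonnegative on its support: the integral is
    positive. *)
Lemma fundamental_lemma S a b n (G : R -> 'cV[R]_n) :
  tame_mx [set: unit] S a b (fun=> G) ->
  (forall Sg dSg : R -> 'cV[R]_n, C1_on a b Sg dSg -> Sg a = 0 -> Sg b = 0 ->
    (\int[lebesgue_measure]_(t in `[a, b]) dotv (G t) (Sg t))%R = 0) ->
  forall t, t \in `]a, b[ -> t \notin S -> G t = 0.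
Proof.
move=> tG G0 t tab tS; apply/eqP/negPn/negP => Gt0.
pose g s := dotv (G s) (G t).
have tg : tame [set: unit] S a b (fun=> g).
  by apply: tame_dotv => // i j; exact: tame_cst.
have gt0 : 0 < g t by exact: dotv_gt0.
have [r /= r0 Hr] : \forall s \near t, (s \in `]a, b[) /\ 0 <= g s.
  apply: filterI; first exact: near_in_itvoo.
  by have /cvgr_ge := tg.1 tt t Logic.I tab tS; exact.
pose q s := r ^+ 2 - (s - t) ^+ 2.
pose phi s := pos_sqr (q s).
(* The support of phi is the ball of radius r, inside ]a, b[. *)
have phi_far s : r <= `|t - s| -> phi s = 0.
  move=> rs; apply/eqP; rewrite eq_le pos_sqr_ge0 andbT leNgt pos_sqr_gt0.
  rewrite subr_gt0 -[(s - t) ^+ 2]real_normK ?num_real// distrC -leNgt.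
  by rewrite ler_pXn2r ?nnegrE// ltW.
have phi0 s : s \notin `]a, b[ -> phi s = 0.
  move=> sab; apply: phi_far; rewrite leNgt; apply/negP => /Hr[].
  by rewrite (negPf sab).
have dq s : is_derive s (1 : R) q (- (2 * (s - t))).
  have := is_deriveB (is_derive_cst (r ^+ 2) s 1)
    (is_deriveX 2 (is_deriveB (is_derive_id s (1 : R)) (is_derive_cst t s 1))).
  by move=> H; apply: (is_derive_eq H); rewrite /= expr1 subr0 sub0r [_ *: 1]mulr1.
pose dphi s := 2 * Num.max (q s) 0 * (- (2 * (s - t))).
have dphiE s : is_derive s (1 : R) phi (dphi s).
  exact: (@is_derive1_comp R pos_sqr q s _ _ (is_derive_pos_sqr (q s)) (dq s)).
have cq : continuous q.
  by move=> s; apply/differentiable_continuous/derivable1_diffP; have [] := dq s.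
have cphi : continuous phi.
  by move=> s; apply/differentiable_continuous/derivable1_diffP; have [] := dphiE s.
have cdphi : continuous dphi.
  move=> s; apply: cvgM.
    apply: cvgM; first exact: cvg_cst.
    by apply: continuous_max; [exact: cq|exact: cvg_cst].
  apply: cvgN; apply: cvgM; first exact: cvg_cst.
  by apply: cvgB; [exact: cvg_id|exact: cvg_cst].
have C1 : C1_on a b (fun s => phi s *: G t) (fun s => dphi s *: G t).
  split.
  - by apply: continuous_subspaceT => s; apply: cvgZ; [exact: cphi|exact: cvg_cst].
  - by apply: continuous_subspaceT => s; apply: cvgZ; [exact: cdphi|exact: cvg_cst].
  - move=> s _; apply/is_derive_mxP => i j; rewrite mxE.
    have -> : (fun x => (phi x *: G t) i j) = (fun x => G t i j * phi x).
      by apply/funext => x; rewrite mxE mulrC.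
    rewrite mulrC; exact: (is_deriveZ (G t i j) (dphiE s)).
have := G0 _ _ C1; rewrite !phi0 ?in_itv/= ?ltxx ?andbF// !scale0r.
move=> /(_ erefl erefl); apply/eqP; rewrite gt_eqF//.
have -> : (\int[lebesgue_measure]_(t0 in `[a, b]) dotv (G t0) (phi t0 *: G t))%R =
    (\int[lebesgue_measure]_(s in `[a, b]) (phi s * g s))%R.
  by apply: eq_Rintegral => s _; rewrite dotvZr.
apply: (tame_integral_gt0 (S := S) (t := t)) => //.
- apply: tameM => //; split=> [_ s _ _ _|]; first exact: cphi.
  have ab : a < b by move: tab; rewrite in_itv/= => /andP[]; exact: lt_trans.
  exact: (tame_within_continuous [::] ab (continuous_subspaceT cphi)).2.
- move=> s _; have [gs|gs] := leP 0 (g s); first by rewrite mulr_ge0// pos_sqr_ge0.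
  rewrite [phi s]phi_far ?mul0r// leNgt; apply/negP => /Hr[_].
  by rewrite leNgt gs.
- by rewrite mulr_gt0// pos_sqr_gt0 /q subrr expr0n subr0 exprn_gt0.
Qed.

End fundamental_lemma.

(** * Variations with a prescribed generator *)

Section admissible_variations.
Context {R : realType}.

(** The Cayley transform of e a is 1 + c a^x + e c (a^x)^2, where c is the
    coefficient below and q = |a|^2. *)
Definition cayley_coef (q e : R) : R := 2 * e / (1 + e ^+ 2 * q).

Definition dcayley_coef (q e : R) : R :=
  2 / (1 + e ^+ 2 * q) - (2 * e) / (1 + e ^+ 2 * q) ^+ 2 * (2 * e * q).

Lemma cayley_den_neq0 (q e : R) : 0 <= q -> 1 + e ^+ 2 * q != 0.
Proof. by move=> q0; rewrite gt_eqF// ltr_pwDl// mulr_ge0// sqr_ge0. Qed.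

Lemma cayleyZ (e : R) (a : 'cV[R]_3) :
  cayley (e *: a) = 1 + (cayley_coef (dotv a a) e *: hat a
    + (e * cayley_coef (dotv a a) e) *: (hat a * hat a)).
Proof.
rewrite /cayley_coef /cayley.
have -> : dotv (e *: a) (e *: a) = e ^+ 2 * dotv a a.
  by rewrite dotvZl dotvZr mulrA.
set d := 1 + e ^+ 2 * _; rewrite hatZ -scalerAl -scalerAr scalerDr.
by rewrite !scalerA; congr (_ + (_ *: _ + _ *: _)); ring.
Qed.

Lemma is_derive_cayley_coef (q e : R) : 0 <= q ->
  is_derive e (1 : R) (cayley_coef q) (dcayley_coef q e).
Proof.
move=> q0; have den0 := cayley_den_neq0 e q0.
have scE (x y : R) : x *: (y : R^o) = x * y by [].
have dden : is_derive e (1 : R) (fun x => 1 + x ^+ 2 * q) (2 * e * q).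
  have := is_deriveD (is_derive_cst (1 : R) e (1 : R))
    (is_deriveZ q (is_deriveX 2 (is_derive_id e (1 : R)))).
  have -> : cst 1 + q \*: (id : R -> R) ^+ 2 = (fun x => 1 + x ^+ 2 * q).
    by apply/funext => x; rewrite [RHS](_ : _ = 1 + q * (x * x)) // mulrC.
  by move=> H; apply: (is_derive_eq H); rewrite /= expr1 !scE; ring.
have := is_deriveM (is_deriveZ 2 (is_derive_id e (1 : R)))
  (@is_deriveV R (fun x => 1 + x ^+ 2 * q) e _ _ den0 dden).
move=> H; apply: (is_derive_eq H).
rewrite /dcayley_coef /= !scE.
by move: den0 => /= den0; field.
Qed.

Lemma cvg_within_snd (V : topologicalType) (a b r : R) (f : R -> V) (p : R * R) :
  let box := [set p : R * R | `|p.1| < r /\ p.2 \in `[a, b]] in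
  {within `[a, b], continuous f} -> box p ->
  f x.2 @[x --> within box (nbhs p)] --> f p.2.
Proof.
move=> box /subspace_continuousP cf [p1 p2].
apply: cvg_comp (cf p.2 p2) => U; rewrite /within/= => fU.
have H : nbhs p [set x | `[a, b]%classic x.2 -> U x.2].
  exact: (@cvg_snd _ _ (nbhs p.1) (nbhs p.2) _ _ fU).
change (nbhs p [set x | box x -> U x.2]).
by apply: filterS H => x Ux [_ x2]; exact: Ux.
Qed.

(** The attitudes Rh (t) cayley (e Sg(t) / 2) stay in SO(3) and leave Rh with
    velocity Rh Sg^x; the factor 1/2 is there because the differential of
    [cayley] at 0 is 2 a^x.  The velocities may vary linearly in e, since a
    variation prescribes their derivative at e = 0 only. *)
Lemma exists_variation (t0 tf : R) (Rh : R -> 'M[R]_3) (Oh : R -> 'cV[R]_3)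
    (Sg dSg : R -> 'cV[R]_3) :
  (forall t, t \in `[t0, tf] -> is_special_orthogonal (Rh t)) ->
  {within `[t0, tf], continuous Rh} -> {within `[t0, tf], continuous Oh} ->
  C1_on t0 tf Sg dSg ->
  exists Rv Ov, Defs.variation t0 tf Rh Oh Sg dSg Rv Ov.
Proof.
move=> RSO cR cO [cS cdS _].
pose a t := 2^-1 *: Sg t; pose q t := dotv (a t) (a t).
have q0 t : 0 <= q t by exact: dotv_ge0.
pose A t := hat (a t).
pose Rv e t := Rh t *m (1 + (cayley_coef (q t) e *: A t
  + (e * cayley_coef (q t) e) *: (A t *m A t))).
have RvE e t : Rv e t = Rh t *m cayley (e *: a t) by rewrite /Rv cayleyZ.
pose dRv e t := Rh t *m (dcayley_coef (q t) e *: A t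
  + (cayley_coef (q t) e + e * dcayley_coef (q t) e) *: (A t *m A t)).
pose dO t := dSg t + cross (Oh t) (Sg t).
pose Ov e t := Oh t + e *: dO t.
exists Rv, Ov, 1, dRv, (fun _ => dO).
set box := [set p : R * R | `|p.1| < 1 /\ p.2 \in `[t0, tf]].
have cf1 p : box p -> x.1 @[x --> within box (nbhs p)] --> p.1.
  by move=> _; apply: cvg_within_filter; exact: cvg_fst.
have cRh p : box p -> Rh x.2 @[x --> within box (nbhs p)] --> Rh p.2.
  exact: cvg_within_snd.
have cSg p : box p -> Sg x.2 @[x --> within box (nbhs p)] --> Sg p.2.
  exact: cvg_within_snd.
have cOh p : box p -> Oh x.2 @[x --> within box (nbhs p)] --> Oh p.2.
  exact: cvg_within_snd.
have cdSg p : box p -> dSg x.2 @[x --> within box (nbhs p)] --> dSg p.2.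
  exact: cvg_within_snd.
have ca p : box p -> a x.2 @[x --> within box (nbhs p)] --> a p.2.
  by move=> bp; apply: cvgZ; [exact: cvg_cst|exact: cSg].
have cq p : box p -> q x.2 @[x --> within box (nbhs p)] --> q p.2.
  by move=> bp; apply: cvg_dotv; exact: ca.
have cA p : box p -> A x.2 @[x --> within box (nbhs p)] --> A p.2.
  by move=> bp; apply: cvg_hat; exact: ca.
have cden p : box p ->
    1 + x.1 ^+ 2 * q x.2 @[x --> within box (nbhs p)] --> 1 + p.1 ^+ 2 * q p.2.
  move=> bp; apply: cvgD; first exact: cvg_cst.
  apply: cvgM; last exact: cq.
  by apply: cvgM; exact: cf1.
have cdenV p : box p -> (1 + x.1 ^+ 2 * q x.2)^-1 @[x --> within box (nbhs p)]
    --> (1 + p.1 ^+ 2 * q p.2)^-1.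
  by move=> bp; apply: cvgV; [exact: cayley_den_neq0|exact: cden].
have c2e p : box p -> 2 * x.1 @[x --> within box (nbhs p)] --> 2 * p.1.
  by move=> bp; apply: cvgM; [exact: cvg_cst|exact: cf1].
have ccoef p : box p -> cayley_coef (q x.2) x.1 @[x --> within box (nbhs p)]
    --> cayley_coef (q p.2) p.1.
  by move=> bp; apply: cvgM; [exact: c2e|exact: cdenV].
have cdcoef p : box p -> dcayley_coef (q x.2) x.1 @[x --> within box (nbhs p)]
    --> dcayley_coef (q p.2) p.1.
  move=> bp; apply: cvgB; first by apply: cvgM; [exact: cvg_cst|exact: cdenV].
  apply: cvgM; last by apply: cvgM; [exact: c2e|exact: cq].
  apply: cvgM; first exact: c2e.
  under eq_cvg do rewrite -exprVn; rewrite -exprVn.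
  by apply: cvgM; exact: cdenV.
have cdO p : box p -> dO x.2 @[x --> within box (nbhs p)] --> dO p.2.
  move=> bp; apply: cvgD; first exact: cdSg.
  by apply: cvg_cross; [exact: cOh|exact: cSg].
split.
- by [].
- split; split.
  + apply/subspace_continuousP => p bp; apply: cvg_mulmx; first exact: cRh.
    apply: cvgD; first exact: cvg_cst.
    apply: cvgD; first by apply: cvgZ; [exact: ccoef|exact: cA].
    apply: cvgZ; first by apply: cvgM; [exact: cf1|exact: ccoef].
    by apply: cvg_mulmx; exact: cA.
  + apply/subspace_continuousP => p bp; apply: cvg_mulmx; first exact: cRh.
    apply: cvgD; first by apply: cvgZ; [exact: cdcoef|exact: cA].
    apply: cvgZ; last by apply: cvg_mulmx; exact: cA.
    apply: cvgD; first exact: ccoef.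
    by apply: cvgM; [exact: cf1|exact: cdcoef].
  + move=> e t _ _; have dc := is_derive_cayley_coef e (q0 t).
    have dec := is_deriveM (is_derive_id e (1 : R)) dc.
    have H := is_deriveD (is_derive_cst (Rh t) e (1 : R))
      (is_deriveD (is_derive_scalemx (Rh t *m A t) dc)
                  (is_derive_scalemx (Rh t *m (A t *m A t)) dec)).
    (* For fixed t, scalar functions of e times constant matrices. *)
    have -> : Rv ^~ t = cst (Rh t) +
        ((fun x => cayley_coef (q t) x *: (Rh t *m A t)) +
         (fun x => (id * cayley_coef (q t) : R -> R) x *: (Rh t *m (A t *m A t)))).
      by apply/funext => x; rewrite /Rv !mulmxDr mulmx1 -!scalemxAr.
    apply: (is_derive_eq H); rewrite /dRv add0r mulmxDr -!scalemxAr.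
    congr (_ + _ *: _).
    by rewrite addrC; congr (_ + _); exact: mulr1.
  + apply/subspace_continuousP => p bp; apply: cvgD; first exact: cOh.
    by apply: cvgZ; [exact: cf1|exact: cdO].
  + by apply/subspace_continuousP => p bp; exact: cdO.
  + move=> e t _ _.
    have H := is_deriveD (is_derive_cst (Oh t) e (1 : R))
      (is_derive_scalemx (dO t) (is_derive_id e (1 : R))).
    by apply: (is_derive_eq H); rewrite add0r scale1r.
- by move=> e t _ tab; rewrite RvE; apply: so_mul; [exact: RSO|exact: cayley_so].
- move=> t _; rewrite /Rv /Ov /cayley_coef mulr0 !mul0r !scale0r !addr0.
  by rewrite mulmx1.
- move=> t _; split=> //; rewrite /dRv /cayley_coef /dcayley_coef.
  rewrite !(mulr0, mul0r) expr0n/= mul0r !addr0 subr0 divr1 scale0r addr0.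
  by rewrite /A -hatZ /a scalerA divff ?pnatr_eq0// scale1r.
Qed.

End admissible_variations.

(** * The filter equations *)

Unset Implicit Arguments.

Theorem theorem3p1 (R : realType) (t0 tf : R) (ht : t0 < tf)
    (* switching times, observed vectors with their weights, measured vectors *)
    (S : seq R) (o : R -> observation R) (u : R -> nat -> 'cV[R]_3)
    (ho : forall t, t \in `[t0, tf] -> valid_observation (o t))
    (hoS : piecewise_constant S t0 tf o)
    (huS : forall i, piecewise_continuous S t0 tf (fun t => u t i))
    (* true motion and measurement models *)
    (Rt : R -> 'M[R]_3) (Omega : R -> 'cV[R]_3)
    (hRtSO : forall t, t \in `[t0, tf] -> is_special_orthogonal (Rt t))
    (hRtC : {within `[t0, tf], continuous Rt})
    (hRt : forall t, t \in `]t0, tf[ ->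
       is_derive t 1 Rt (Rt t *m hat (Omega t)))
    (N : forall t, 'M[R]_(3, ncols (size (known (o t)))))
    (hU : forall t, t \in `[t0, tf] ->
       Umx (o t) (u t) = (Rt t)^T *m Emx (o t) + N t)
    (Omega_m w : R -> 'cV[R]_3) (beta : 'cV[R]_3)
    (hOm : forall t, t \in `[t0, tf] -> Omega_m t = Omega t + w t + beta)
    (* filter parameters *)
    (m : R) (hm : 0 < m) (D : 'M[R]_3) (hD : posdef D)
    (Phi dPhi : R -> R) (hPhi : admissible_potential Phi dPhi)
    (* estimates *)
    (Rhat : R -> 'M[R]_3) (Omegahat betahat : R -> 'cV[R]_3)
    (hRhSO : forall t, t \in `[t0, tf] -> is_special_orthogonal (Rhat t))
    (hRhC : {within `[t0, tf], continuous Rhat})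
    (hRh : forall t, t \in `]t0, tf[ ->
       is_derive t 1 Rhat (Rhat t *m hat (Omegahat t)))
    (hOhC : {within `[t0, tf], continuous Omegahat})
    (hom : piecewise_C1 S t0 tf (velocity_error Omega_m Omegahat betahat))
    (* initial values *)
    (Rhat0 : 'M[R]_3) (Omega_m0 Omegahat0 betahat0 : 'cV[R]_3)
    (hR0 : Rhat t0 = Rhat0) (hOm0 : Omega_m t0 = Omega_m0)
    (hOh0 : Omegahat t0 = Omegahat0) (hb0 : betahat t0 = betahat0) :
  lagrange_dalembert t0 tf m D Phi o u Omega_m betahat Rhat Omegahat <->
  filter_equations S t0 tf m D dPhi o u Omega_m betahat
    Rhat0 (Omega_m0 - Omegahat0 - betahat0)
    Rhat Omegahat (velocity_error Omega_m Omegahat betahat).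
Proof.
have om_cont : {within `[t0, tf],
    continuous (velocity_error Omega_m Omegahat betahat)} by have [] := hom.
pose res := residual o u m D dPhi Omega_m betahat Rhat Omegahat.
have tres : tame_mx [set: unit] S t0 tf (fun=> res).
  exact: (tame_residual ht ho hoS huS m D hPhi hRhSO hRhC hOhC hom).
have keyE Sg dSg Rv Ov : C1_on t0 tf Sg dSg -> Sg t0 = 0 -> Sg tf = 0 ->
    Defs.variation t0 tf Rhat Omegahat Sg dSg Rv Ov ->
    let A (e : R) := action t0 tf m Phi o u Omega_m betahat (Rv e) (Ov e) in
    derivable A 0 1 /\
    derive1 A 0 + (\int[lebesgue_measure]_(t in `[t0, tf])
      dotv (D *m velocity_error Omega_m Omegahat betahat t) (Sg t))%R =
    (\int[lebesgue_measure]_(t in `[t0, tf]) dotv (res t) (Sg t))%R.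
  exact: (lagrange_dalembert_residual ht ho hoS huS m D hPhi hRhSO hRhC hOhC hom).
have OhE t : Omegahat t =
    Omega_m t - velocity_error Omega_m Omegahat betahat t - betahat t.
  by rewrite /velocity_error !opprB addrA addrC; apply/matrixP => i j; rewrite !mxE; ring.
split=> [LdA|[_ omE _ _]].
- have res0 : forall t, t \in `]t0, tf[ -> t \notin S -> res t = 0.
    apply: (fundamental_lemma tres) => Sg dSg C1 Sg0 Sgf.
    have [Rv [Ov var]] := exists_variation hRhSO hRhC hOhC C1.
    have [_ <-] := keyE Sg dSg Rv Ov C1 Sg0 Sgf var.
    by have [] := LdA Sg dSg C1 Sg0 Sgf Rv Ov var.
  split=> [t tab|t tab tS|t _|].
  + by split; [exact: hRh|rewrite -OhE].
  + split; first by have [_ + _] := hom; apply.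
    have /eqP := res0 t tab tS; rewrite /res /residual => /eqP res_t.
    apply/eqP; rewrite -subr_eq0; apply/eqP; rewrite -{}res_t.
    by rewrite !opprD !opprK !addrA.
  + exact: OhE.
  + by rewrite -hR0 -hOm0 -hOh0 -hb0.
- move=> Sg dSg C1 Sg0 Sgf Rv Ov var.
  have [dA AE] := keyE Sg dSg Rv Ov C1 Sg0 Sgf var.
  split; [exact: dA|rewrite AE].
  have [cSg _ _] := C1.
  have tSg := tame_within_mx S ht cSg.
  apply: (Rintegral_off_finite_eq0 ht (tame_dotv tres tSg)).
  move=> t tab tS; have [_ omE_t] := omE t tab tS.
  rewrite (_ : res t = 0) ?/dotv ?trmx0 ?mul0mx ?mxE//.
  rewrite /res /residual omE_t.
  by apply/matrixP => i j; rewrite !mxE; ring.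
Qed.
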